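(* Let $A$ be a regular ring containing $\mathbb{F}_p$ that admits an absolute $p$-basis $\mathcal{B}$. Let $J=\langle f_1,\dots,f_s\rangle$ be an ideal of $A$, and let $P\subset A$ be a prime ideal with $J\subset P$. Set $C=A/J$ and $\mathfrak{p}=P/J\subset C$. Then: (i) There is a finite subset $\{b_1,\dots,b_m\}\subset\mathcal{B}$ such that $\frac{\partial f_1}{\partial b'}=\dots=\frac{\partial f_s}{\partial b'}=0$ for every $b'\in\mathcal{B}\setminus\{b_1,\dots,b_m\}$. (ii) Assume that $\operatorname{height}(JA_P)=r$. Then, for $b_1,\dots,b_m$ as in (i), $C_{\mathfrak{p}}$ is regular if and only if the Jacobian matrix $$\begin{pmatrix}\frac{\partial f_1}{\partial b_1}&\cdots&\frac{\partial f_1}{\partial b_m}\\ \vdots&\ddots&\vdots\\ \frac{\partial f_s}{\partial b_1}&\cdots&\frac{\partial f_s}{\partial b_m}\end{pmatrix}$$ has rank $r$ modulo $P$ (that is, if and only if it contains an $r\times r$ minor whose determinant is non-zero modulo $P$).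
   Context: Regular rings are Noetherian. For a ring $A$ of characteristic $p$, put $A^p=\{a^p\mid a\in A\}$. A (possibly infinite) subset $\mathcal{B}\subset A$ is an absolute $p$-basis of $A$ if $A$ is a free $A^p$-module with basis the family of $p$-monomials $b_1^{\alpha_1}\cdots b_r^{\alpha_r}$, with $r\in\mathbb{N}$, $b_1,\dots,b_r\in\mathcal{B}$ distinct and $0\le\alpha_i<p$. Given an absolute $p$-basis $\mathcal{B}$ of $A$, for each $b\in\mathcal{B}$ there is a unique derivation $\frac{\partial}{\partial b}:A\to A$ (over $\mathbb{F}_p$) such that $\frac{\partial}{\partial b}(c)=\delta_{bc}$ (Kronecker delta) for all $c\in\mathcal{B}$. *)

(* Defs.v *)
From HB Require Import structures.
From mathcomp Require Import all_boot all_algebra generic_quotient ring_quotient fraction.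
From mathcomp Require Import ring.
From mathcomp Require Import finmap boolp classical_sets.

Set Implicit Arguments.
Unset Strict Implicit.
Unset Printing Implicit Defensive.

Import GRing.Theory.
Local Open Scope classical_set_scope.
Local Open Scope ring_scope.
Local Open Scope quotient_scope.

(* Ideals are the proper ideals [idealr R] and the prime ideals               *)
(* [prime_idealr R] of ring_quotient.v. These are boolean predicates, but     *)
(* with the classical axioms of boolp every ideal is of this form.            *)

Definition ideal_span (R : comNzRingType) (S : set R) : set R :=
  [set x | exists (n : nat) (c g : 'I_n -> R),
     (forall i, S (g i)) /\ x = \sum_(i < n) c i * g i].

(* Restricting to proper ideals is harmless: the unit ideal is spanned by 1. *)
Definition noetherian (R : comNzRingType) : Prop :=
  forall I : idealr R, exists (n : nat) (g : 'I_n -> R),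
    [set x | x \in I] = ideal_span (range g).

Definition maximal_ideal (R : comNzRingType) (M : idealr R) : Prop :=
  forall I : idealr R, {subset M <= I} -> {subset I <= M}.

Definition local_ring (R : comNzRingType) (M : idealr R) : Prop :=
  maximal_ideal M /\ forall N : idealr R, maximal_ideal N -> N =i M.

Definition prime_lt (R : comNzRingType) (P Q : prime_idealr R) : Prop :=
  {subset P <= Q} /\ ~ {subset Q <= P}.

(* There is a chain q_0 < ... < q_n = Q of primes; only the terms of index at *)
(* most n of the sequence q matter.                                           *)
Definition height_ge (R : comNzRingType) (Q : prime_idealr R) (n : nat) : Prop :=
  exists q : nat -> prime_idealr R,
    q n =i Q /\ forall i, (i < n)%N -> prime_lt (q i) (q i.+1).

(* The height of an ideal is the minimum of the heights of the primes that    *)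
(* contain it; heights may be infinite, hence relations and not functions.    *)
Definition ideal_height (R : comNzRingType) (I : set R) (n : nat) : Prop :=
  (forall Q : prime_idealr R, I `<=` [set x | x \in Q] -> height_ge Q n) /\
  (exists2 Q : prime_idealr R, I `<=` [set x | x \in Q] & ~ height_ge Q n.+1).

Definition krull_dim (R : comNzRingType) (n : nat) : Prop :=
  (exists Q : prime_idealr R, height_ge Q n) /\
  (forall Q : prime_idealr R, ~ height_ge Q n.+1).

Definition regular_local (R : comNzRingType) : Prop :=
  noetherian R /\
  exists (M : idealr R) (d : nat) (g : 'I_d -> R),
    [/\ local_ring M, krull_dim R d & [set x | x \in M] = ideal_span (range g)].

Section Localization.
Variables (R : comNzRingType) (P : prime_idealr R).

Record locfrac := LocFrac { locpair :> R * R; _ : locpair.2 \notin P }.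
HB.instance Definition _ := [isSub for locpair].
HB.instance Definition _ := [Choice of locfrac by <:].

Implicit Types x y z : locfrac.

Lemma locden x : x.2 \notin P. Proof. by case: x. Qed.

Lemma one_notin_prime : 1 \notin P. Proof. by rewrite idealr1. Qed.

Lemma mul_notin_prime u v : u \notin P -> v \notin P -> u * v \notin P.
Proof. by rewrite prime_idealrM negb_or => -> ->. Qed.

Definition equivloc x y : bool :=
  `[< exists2 u, u \notin P & u * (x.1 * y.2 - y.1 * x.2) = 0 >].

Lemma equivloc_refl : reflexive equivloc.
Proof.
by move=> x; apply/asboolP; exists 1; rewrite ?one_notin_prime // subrr mulr0.
Qed.

Lemma equivloc_sym : symmetric equivloc.
Proof.
by move=> x y; apply/asboolP/asboolP => -[u uP uE]; exists u => //;
  rewrite -opprB mulrN uE oppr0.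
Qed.

Lemma equivloc_trans : transitive equivloc.
Proof.
move=> y x z /asboolP[u uP uE] /asboolP[v vP vE]; apply/asboolP.
exists (u * v * y.2); first by rewrite !mul_notin_prime ?locden.
have -> : u * v * y.2 * (x.1 * z.2 - z.1 * x.2) =
   v * z.2 * (u * (x.1 * y.2 - y.1 * x.2)) +
   u * x.2 * (v * (y.1 * z.2 - z.1 * y.2)) by ring.
by rewrite uE vE !mulr0 addr0.
Qed.

Canonical equivloc_equiv :=
  EquivRel equivloc equivloc_refl equivloc_sym equivloc_trans.

Definition localization := {eq_quot equivloc}.

HB.instance Definition _ : EqQuotient _ equivloc localization :=
  EqQuotient.on localization.
HB.instance Definition _ := Choice.on localization.

Lemma loc_eqP x y : reflect
  (exists2 u, u \notin P & u * (x.1 * y.2 - y.1 * x.2) = 0)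
  (\pi_localization x == \pi_localization y).
Proof. by rewrite eqmodE; apply: asboolP. Qed.

Lemma loc_repr x :
  exists2 u, u \notin P & u * (x.1 * (repr (\pi_localization x)).2
                               - (repr (\pi_localization x)).1 * x.2) = 0.
Proof. by apply/loc_eqP; rewrite reprK. Qed.

Lemma loc_ext (x y : locfrac) : x.1 * y.2 = y.1 * x.2 ->
  \pi_localization x = \pi_localization y.
Proof.
move=> xy; apply/eqP/loc_eqP; exists 1; first exact: one_notin_prime.
by rewrite xy subrr mulr0.
Qed.

Definition addlf x y : locfrac :=
  @LocFrac (x.1 * y.2 + y.1 * x.2, x.2 * y.2) (mul_notin_prime (locden x) (locden y)).
Definition opplf x : locfrac := @LocFrac (- x.1, x.2) (locden x).
Definition mullf x y : locfrac :=
  @LocFrac (x.1 * y.1, x.2 * y.2) (mul_notin_prime (locden x) (locden y)).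
Definition inlf (a : R) : locfrac := @LocFrac (a, 1) one_notin_prime.

Definition loc_add := lift_op2 localization addlf.
Definition loc_opp := lift_op1 localization opplf.
Definition loc_mul := lift_op2 localization mullf.
Definition to_loc := lift_embed localization inlf.
Canonical to_loc_pi_morph := PiEmbed to_loc.

Lemma pi_loc_add : {morph \pi : x y / addlf x y >-> loc_add x y}.
Proof.
move=> x y; unlock loc_add; apply/eqP/loc_eqP => /=.
have [u uP uE] := loc_repr x; have [v vP vE] := loc_repr y.
move: uE vE; set x' := repr _; set y' := repr _ => uE vE.
exists (u * v); first exact: mul_notin_prime.
transitivity (v * y.2 * y'.2 * (u * (x.1 * x'.2 - x'.1 * x.2)) +
   u * x.2 * x'.2 * (v * (y.1 * y'.2 - y'.1 * y.2))); first by ring.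
by rewrite uE vE !mulr0 addr0.
Qed.
Canonical pi_loc_add_morph := PiMorph2 pi_loc_add.

Lemma pi_loc_opp : {morph \pi : x / opplf x >-> loc_opp x}.
Proof.
move=> x; unlock loc_opp; apply/eqP/loc_eqP => /=.
have [u uP uE] := loc_repr x; exists u => //.
by rewrite -[RHS]oppr0 -uE; ring.
Qed.
Canonical pi_loc_opp_morph := PiMorph1 pi_loc_opp.

Lemma pi_loc_mul : {morph \pi : x y / mullf x y >-> loc_mul x y}.
Proof.
move=> x y; unlock loc_mul; apply/eqP/loc_eqP => /=.
have [u uP uE] := loc_repr x; have [v vP vE] := loc_repr y.
move: uE vE; set x' := repr _; set y' := repr _ => uE vE.
exists (u * v); first exact: mul_notin_prime.
transitivity (v * y.1 * y'.2 * (u * (x.1 * x'.2 - x'.1 * x.2)) +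
   u * x.2 * x'.1 * (v * (y.1 * y'.2 - y'.1 * y.2))); first by ring.
by rewrite uE vE !mulr0 addr0.
Qed.
Canonical pi_loc_mul_morph := PiMorph2 pi_loc_mul.

Lemma loc_addA : associative loc_add.
Proof.
elim/quotW=> x; elim/quotW=> y; elim/quotW=> z; rewrite !piE.
by apply: loc_ext => /=; ring.
Qed.

Lemma loc_addC : commutative loc_add.
Proof.
by elim/quotW=> x; elim/quotW=> y; rewrite !piE; apply: loc_ext => /=; ring.
Qed.

Lemma loc_add0 : left_id (to_loc 0) loc_add.
Proof. by elim/quotW=> x; rewrite !piE; apply: loc_ext => /=; ring. Qed.

Lemma loc_addN : left_inverse (to_loc 0) loc_opp loc_add.
Proof. by elim/quotW=> x; rewrite !piE; apply: loc_ext => /=; ring. Qed.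

HB.instance Definition _ :=
  GRing.isZmodule.Build localization loc_addA loc_addC loc_add0 loc_addN.

Lemma loc_mulA : associative loc_mul.
Proof.
elim/quotW=> x; elim/quotW=> y; elim/quotW=> z; rewrite !piE.
by apply: loc_ext => /=; ring.
Qed.

Lemma loc_mulC : commutative loc_mul.
Proof.
by elim/quotW=> x; elim/quotW=> y; rewrite !piE; apply: loc_ext => /=; ring.
Qed.

Lemma loc_mul1 : left_id (to_loc 1) loc_mul.
Proof. by elim/quotW=> x; rewrite !piE; apply: loc_ext => /=; ring. Qed.

Lemma loc_mulDl : left_distributive loc_mul loc_add.
Proof.
elim/quotW=> x; elim/quotW=> y; elim/quotW=> z; rewrite !piE.
by apply: loc_ext => /=; ring.
Qed.

Lemma loc_one_neq0 : to_loc 1 != to_loc 0.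
Proof.
rewrite !piE; apply/asboolP => -[u /= uP uE].
by move: uP; rewrite -[u]mulr1 -[X in u * X]subr0 -{1}[1]mulr1 -[0](mul0r 1) uE rpred0.
Qed.

HB.instance Definition _ := GRing.Zmodule_isComNzRing.Build localization
  loc_mulA loc_mulC loc_mul1 loc_mulDl loc_one_neq0.

Lemma to_loc_is_zmod_morphism : zmod_morphism to_loc.
Proof.
move=> a b; rewrite !piE; apply: loc_ext => /=; ring.
Qed.
HB.instance Definition _ :=
  GRing.isZmodMorphism.Build R localization to_loc to_loc_is_zmod_morphism.

Lemma to_loc_is_monoid_morphism : monoid_morphism to_loc.
Proof. by split=> // a b; rewrite !piE; apply: loc_ext => /=; ring. Qed.
HB.instance Definition _ :=
  GRing.isMonoidMorphism.Build R localization to_loc to_loc_is_monoid_morphism.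

End Localization.

Definition regular_ring (R : comNzRingType) : Prop :=
  noetherian R /\ forall P : prime_idealr R, regular_local (localization P).

Section PrimeQuotient.
Variables (R : comNzRingType) (J : idealr R) (P : prime_idealr R).

(* P / J in R / J. *)
Definition prime_quot (sJP : {subset J <= P}) : pred {ideal_quot J} :=
  fun c => `[< exists2 x, x \in P & c = \pi x >].

Variable sJP : {subset J <= P}.

Lemma prime_quotE x : (\pi x \in prime_quot sJP) = (x \in P).
Proof.
apply/asboolP/idP => [[y yP /eqP]|xP]; last by exists x.
by rewrite -Quotient.idealrBE => /sJP xyP; rewrite -[x](subrK y) rpredD.
Qed.

Lemma prime_quot_idealr_closed : idealr_closed (prime_quot sJP).
Proof.
split; first by rewrite -[0](rmorph0 \pi) prime_quotE rpred0.
  by rewrite -[1](rmorph1 \pi) prime_quotE idealr1.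
move=> a u v; rewrite -[a]reprK -[u]reprK -[v]reprK.
rewrite -rmorphM -rmorphD !prime_quotE => uP vP.
by rewrite rpredD // idealMr.
Qed.
HB.instance Definition _ :=
  isIdealr.Build {ideal_quot J} (prime_quot sJP) prime_quot_idealr_closed.

Lemma prime_quot_prime : prime_idealr_closed (prime_quot sJP).
Proof.
move=> u v; rewrite -[u]reprK -[v]reprK.
by rewrite -rmorphM !prime_quotE prime_idealrM.
Qed.
HB.instance Definition _ :=
  isPrimeIdealrClosed.Build {ideal_quot J} (prime_quot sJP) prime_quot_prime.

End PrimeQuotient.

Section PrimeDomain.
Variables (R : comNzRingType) (P : prime_idealr R).

(* R / P with its structure of integral domain; units are classical. *)
Definition dom_quot := {ideal_quot P}.
HB.instance Definition _ := GRing.ComNzRing.on dom_quot.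

Definition dom_quot_unit : pred dom_quot := fun x => `[< exists y, y * x = 1 >].
Definition dom_quot_inv (x : dom_quot) : dom_quot :=
  xget x [set y : dom_quot | y * x = 1].

Lemma dom_quot_mulVx : {in dom_quot_unit, left_inverse 1 dom_quot_inv *%R}.
Proof.
move=> x /asboolP[y yx]; rewrite /dom_quot_inv.
by case: xgetP => [z _ //|/(_ y)]; case.
Qed.

Lemma dom_quot_unitPl (x y : dom_quot) : y * x = 1 -> dom_quot_unit x.
Proof. by move=> yx; apply/asboolP; exists y. Qed.

Lemma dom_quot_inv_out : {in [predC dom_quot_unit], dom_quot_inv =1 id}.
Proof.
move=> x /asboolPn nx; rewrite /dom_quot_inv.
by case: xgetP => // z _ zx; case: nx; exists z.
Qed.

HB.instance Definition _ := GRing.ComNzRing_hasMulInverse.Build dom_quot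
  dom_quot_mulVx dom_quot_unitPl dom_quot_inv_out.
HB.instance Definition _ := GRing.ComUnitRing_isIntegral.Build dom_quot
  (@Quotient.rquot_IdomainAxiom R P).

Definition residue_field := {fraction dom_quot}.

Definition to_residue (a : R) : residue_field :=
  @FracField.tofrac dom_quot (\pi_dom_quot a).

Definition rank_mod (m n : nat) (M : 'M[R]_(m, n)) : nat :=
  \rank (map_mx to_residue M).

End PrimeDomain.

Section PBasis.
Variables (p : nat) (A : comNzRingType).

Definition pth_powers : set A := range (fun a : A => a ^+ p).

(* The family (e i)_{i in S} is a basis of A as a module over the subring K. *)
Definition module_basis (K : set A) (I : choiceType) (S : set I) (e : I -> A) :
    Prop :=
  (forall a : A, exists (E : {fset I}) (c : I -> A),
     (forall i, i \in E -> S i /\ K (c i)) /\ a = \sum_(i <- E) c i * e i) /\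
  (forall (E : {fset I}) (c : I -> A),
     (forall i, i \in E -> S i /\ K (c i)) ->
     \sum_(i <- E) c i * e i = 0 -> forall i, i \in E -> c i = 0).

(* A p-monomial is given by its exponents: a finitely supported function from *)
(* B to {0, ..., p - 1}, extended by 0 outside of B. In this way each         *)
(* p-monomial occurs once in the family, trivial factors b ^ 0 being omitted. *)
Definition pmonom_exp (B : set A) : set {fsfun A -> nat with 0%N} :=
  [set alpha | forall b, (alpha b < p)%N /\ (alpha b != 0%N -> B b)].

Definition pmonom (alpha : {fsfun A -> nat with 0%N}) : A :=
  \prod_(b <- finsupp alpha) b ^+ alpha b.

Definition absolute_p_basis (B : set A) : Prop :=
  module_basis pth_powers (pmonom_exp B) pmonom.

(* Additivity over Z already gives linearity over F_p. *)
Definition derivation (D : A -> A) : Prop :=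
  {morph D : x y / x + y} /\ forall x y, D (x * y) = x * D y + y * D x.

(* d/db, for b in an absolute p-basis B. *)
Definition pderiv (B : set A) (b : A) : A -> A :=
  xget (fun=> 0)
    [set D : A -> A | derivation D /\ forall c, B c -> D c = (b == c)%:R].

(* {b_0, ..., b_(m-1)} is a finite subset of B with m elements such that all  *)
(* d(f_i)/db' vanish for b' in B outside of it.                               *)
Definition deriv_support (B : set A) (s m : nat) (f : 'I_s -> A)
    (b : 'I_m -> A) : Prop :=
  [/\ injective b, (forall i, B (b i)) &
      forall b', B b' -> ~ range b b' -> forall j, pderiv B b' (f j) = 0].

Definition jacobian (B : set A) (s m : nat) (f : 'I_s -> A) (b : 'I_m -> A) :
    'M[A]_(s, m) := \matrix_(i, j) pderiv B (b j) (f i).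

End PBasis.

(* Main.v *)
From HB Require Import structures.
Require Import Defs.
From mathcomp Require Import all_boot all_algebra generic_quotient ring_quotient.
From mathcomp Require Import ring zify.
From mathcomp Require Import finmap boolp classical_sets.

(* All the commutative algebra takes place in [A] itself: ideals of a         *)
(* localization at [P] of a quotient [A / K] are replaced by ideals of [A]    *)
(* that contain [K], up to saturation by the complement of [P]. If [A_P] is   *)
(* regular of dimension d, then elements x_1, ..., x_k of [P] that are        *)
(* independent modulo the square of the maximal ideal generate a prime of     *)
(* height k with regular quotient of dimension d - k. When they generate J    *)
(* modulo the square of the maximal ideal, counting dimensions shows that     *)
(* [A_P / J] is regular iff it is the quotient by the x_i iff the height of J *)
(* is k. Finally, k is the rank of the Jacobian matrix modulo [P] because an  *)
(* element of [P] whose partial derivatives all lie in [P] lies in the square *)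
(* of the maximal ideal: this follows from a first-order Taylor expansion     *)
(* over a coefficient ring that contains all the p-th powers.                 *)

Set Implicit Arguments.
Unset Strict Implicit.
Unset Printing Implicit Defensive.

Import GRing.Theory.
Local Open Scope classical_set_scope.
Local Open Scope ring_scope.

(** * Ideals as sets, saturation, and Nakayama's lemma *)

(** Write m for the maximal ideal of A_P. By [p_basis_ind] every element of A is obtained by sums
    and products from p-th powers and finitely many elements of [B]. Derivations kill p-th powers,
    so each f_j has only finitely many nonzero partial derivatives; this is (i). The partial
    derivatives exist by [pderiv_basis].

    For (ii), let k be the rank of the Jacobian matrix modulo P, and choose k of the generators,
    x_1, ..., x_k, whose rows form a basis of the row space modulo P. By the Leibniz rule the
    gradient modulo P is linear on P and kills P^2, so the x_i are independent in m/m^2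
    ([indep_at_grad]). Conversely, an element of P whose partial derivatives all lie in P belongs to
    m^2 ([pderiv_kernel]). Applied to the relations between rows, with denominators cleared, this
    shows that the x_i span the image of J in m/m^2.

    What remains concerns regular local rings only ([regular_quotient_criterion]). With d the
    dimension of A_P, the x_i generate a prime q of A_P inside JA_P, with regular quotient of
    dimension d - k and at least k steps of primes below it, so k <= r. If k = r, a prime of height
    r over J must be q, so JA_P = q and C is regular at P. If C is regular of dimension e at P, then
    d <= k + e, hence JA_P = q by dimension, and r + e <= d gives r <= k. These counts rest on the
    principal ideal theorem [krull_pit], through [pchain_through].

    The proof of [pderiv_kernel] needs a subring F of A_P that contains all p-th powers, meets m
    inside m^2, and represents the residues of finitely many elements b. Such an F is built by
    adjoining one b at a time ([coef_ring_extend]): a residue beta outside the subfield already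
    reached has minimal polynomial X^p - beta^p over it ([inseparable_free]). *)

Section IdealSets.
Variable R : comNzRingType.
Implicit Types (I J K M N Q U V p q : set R) (a b c x y : R).

(** Unlike [idealr], improper ideals are allowed, so that sums and saturations need no side
    condition. *)
Definition ideal_set I :=
  [/\ I 0, forall a b, I a -> I b -> I (a + b) & forall a b, I b -> I (a * b)].

Definition prime_set p :=
  [/\ ideal_set p, ~ p 1 & forall a b, p (a * b) -> p a \/ p b].

Lemma idl0 I : ideal_set I -> I 0. Proof. by case. Qed.

Lemma idlD I a b : ideal_set I -> I a -> I b -> I (a + b).
Proof. by case=> _ + _; apply. Qed.

Lemma idlMl I a b : ideal_set I -> I b -> I (a * b).
Proof. by case=> _ _; apply. Qed.

Lemma idlMr I a b : ideal_set I -> I a -> I (a * b).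
Proof. by rewrite mulrC; apply: idlMl. Qed.

Lemma idlN I a : ideal_set I -> I a -> I (- a).
Proof. by rewrite -mulN1r; apply: idlMl. Qed.

Lemma idlB I a b : ideal_set I -> I a -> I b -> I (a - b).
Proof. by move=> iI Ia Ib; apply: idlD => //; apply: idlN. Qed.

Lemma idlBK I a b : ideal_set I -> I (a - b) -> I b -> I a.
Proof. by move=> iI Iab Ib; rewrite -[a](subrK b); apply: idlD. Qed.

Lemma idl_sum I (T : Type) (r : seq T) (F : T -> R) :
  ideal_set I -> (forall i, I (F i)) -> I (\sum_(i <- r) F i).
Proof. by move=> iI IF; apply: big_ind => //; [exact: idl0|move=> *; exact: idlD]. Qed.

Lemma ideal_set0 : ideal_set [set 0].
Proof. by split=> // [a b -> ->|a b ->]; rewrite ?addr0 ?mulr0. Qed.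

Lemma prime_ideal p : prime_set p -> ideal_set p. Proof. by case. Qed.

Lemma primeM p a b : prime_set p -> ~ p a -> ~ p b -> ~ p (a * b).
Proof. by move=> [_ _ pM] na nb /pM[]. Qed.

(** For an ideal I this is I + (g); [adjs] adjoins a list of generators. *)
Definition adj I g : set R := [set x | exists c, I (x - c * g)].
Definition adjs I (s : seq R) := foldl adj I s.

Lemma adj_ideal I g : ideal_set I -> ideal_set (adj I g).
Proof.
move=> iI; split.
- by exists 0; rewrite mul0r subr0; apply: idl0.
- move=> a b [c Ia] [d Ib]; exists (c + d).
  have -> : a + b - (c + d) * g = a - c * g + (b - d * g) by ring.
  exact: idlD.
- move=> a b [c Ib]; exists (a * c).
  have -> : a * b - a * c * g = a * (b - c * g) by ring.
  exact: idlMl.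
Qed.

Lemma sub_adj I g : I `<=` adj I g.
Proof. by move=> a Ia; exists 0 => //; rewrite mul0r subr0. Qed.

Lemma mem_adj I g : ideal_set I -> adj I g g.
Proof. by move=> iI; exists 1 => //; rewrite mul1r subrr; apply: idl0. Qed.

Lemma adj_min I g U : ideal_set U -> I `<=` U -> U g -> adj I g `<=` U.
Proof. by move=> iU IU Ug a [c /IU]; move/(idlBK iU); apply; apply: idlMl. Qed.

Lemma adjs_ideal I s : ideal_set I -> ideal_set (adjs I s).
Proof. by elim: s I => //= g s IHs I iI; apply/IHs/adj_ideal. Qed.

Lemma sub_adjs I s : I `<=` adjs I s.
Proof.
by elim: s I => [|g s IHs] I x Ix //=; apply/IHs/sub_adj.
Qed.

Lemma mem_adjs I s g : ideal_set I -> g \in s -> adjs I s g.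
Proof.
elim: s I => //= h s IHs I iI; rewrite inE => /orP[/eqP ->|gs].
  by apply/sub_adjs/mem_adj.
by apply: IHs => //; apply: adj_ideal.
Qed.

Lemma adjs_min I s U : ideal_set U -> I `<=` U ->
  (forall g, g \in s -> U g) -> adjs I s `<=` U.
Proof.
elim: s I => //= h s IHs I iU IU sU; apply: IHs => //.
  by apply: adj_min => //; apply: sU; rewrite mem_head.
by move=> g gs; apply: sU; rewrite inE gs orbT.
Qed.

Lemma adjs_mono I J s : ideal_set J -> I `<=` J -> adjs I s `<=` adjs J s.
Proof.
move=> iJ IJ; apply: adjs_min; first exact: adjs_ideal.
  by move=> x /IJ; apply: sub_adjs.
by move=> g; apply: mem_adjs.
Qed.

(** The contraction to R of the extension of [U] to the localization at [p]. An inclusion of [U] in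
    [sat p V] thus stands for an inclusion of localized ideals. *)
Definition sat p U : set R := [set a | exists2 s, ~ p s & U (s * a)].

Lemma sat_ideal p U : prime_set p -> ideal_set U -> ideal_set (sat p U).
Proof.
move=> pp iU; split.
- by exists 1; [case: pp|rewrite mul1r; apply: idl0].
- move=> a b [s ps Ua] [t pt Ub]; exists (s * t); first exact: primeM.
  have -> : s * t * (a + b) = t * (s * a) + s * (t * b) by ring.
  by apply: idlD => //; apply: idlMl.
- move=> a b [s ps Ub]; exists s => //; rewrite mulrCA.
  exact: idlMl.
Qed.

Lemma sub_sat p U : prime_set p -> U `<=` sat p U.
Proof. by move=> [_ p1 _] a Ua; exists 1 => //; rewrite mul1r. Qed.

Lemma sat_mono p U V : U `<=` V -> sat p U `<=` sat p V.
Proof. by move=> UV a [s ps /UV]; exists s. Qed.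

Lemma sat_id p U : prime_set p -> sat p (sat p U) `<=` sat p U.
Proof.
move=> pp a [s ps [t pt Ua]]; exists (t * s); first exact: primeM.
by rewrite -mulrA.
Qed.

Lemma sat_min p U V : prime_set p -> U `<=` sat p V -> sat p U `<=` sat p V.
Proof. by move=> pp UV x Ux; apply/(sat_id pp)/(sat_mono UV). Qed.

Lemma sat_prime p q : prime_set q -> q `<=` p -> sat p q `<=` q.
Proof. by move=> [_ _ qM] qp a [s ps /qM[/qp|]]. Qed.

Lemma sat_sub_prime p q U : prime_set q -> q `<=` p -> U `<=` q -> sat p U `<=` q.
Proof.
by move=> qq qp Uq x Ux; apply/(sat_prime qq qp)/(sat_mono Uq).
Qed.

Definition mulI I J : set R := [set x | exists2 s : seq (R * R),
  (forall z, z \in s -> I z.1 /\ J z.2) & x = \sum_(z <- s) z.1 * z.2].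

Lemma mulI_ideal I J : ideal_set I -> ideal_set (mulI I J).
Proof.
move=> iI; split.
- by exists [::] => //; rewrite big_nil.
- move=> a b [s Hs ->] [t Ht ->]; exists (s ++ t); last by rewrite big_cat.
  by move=> z; rewrite mem_cat => /orP[/Hs|/Ht].
- move=> a b [s Hs ->]; exists [seq (a * z.1, z.2) | z <- s].
    move=> z /mapP[y /Hs[Iy Jy] ->] /=; split=> //; exact: idlMl.
  by rewrite big_map big_distrr /=; apply: eq_bigr => z _; rewrite mulrA.
Qed.

Lemma mem_mulI I J a b : I a -> J b -> mulI I J (a * b).
Proof.
move=> Ia Jb; exists [:: (a, b)]; last by rewrite big_seq1.
by move=> z; rewrite inE => /eqP ->.
Qed.

Lemma mulI_min I J U : ideal_set U -> (forall a b, I a -> J b -> U (a * b)) ->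
  mulI I J `<=` U.
Proof.
move=> iU H _ [s Hs ->]; rewrite big_seq; apply: big_ind.
- exact: idl0.
- by move=> *; apply: idlD.
- by move=> z /Hs[]; apply: H.
Qed.

Fixpoint ipow q n : set R := if n is n'.+1 then mulI q (ipow q n') else setT.

Lemma ipow_ideal q n : ideal_set q -> ideal_set (ipow q n).
Proof. by move=> iq; case: n => [|n] //=; apply: mulI_ideal. Qed.

Lemma ipowS q n : ideal_set q -> ipow q n.+1 `<=` ipow q n.
Proof.
move=> iq; apply: mulI_min; [exact: ipow_ideal|].
by move=> a b _ bn; apply: idlMl bn; apply: ipow_ideal.
Qed.

(** The ideal N + Qs, with the coefficients peeled off one at a time to suit the induction in
    Nakayama's lemma. *)
Fixpoint qcomb Q N (s : seq R) : set R :=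
  if s is g :: s' then [set x | exists2 c, Q c & qcomb Q N s' (x - c * g)]
  else N.

Lemma qcomb_ideal Q N s : ideal_set Q -> ideal_set N -> ideal_set (qcomb Q N s).
Proof.
move=> iQ iN; elim: s => //= g s IHs; split.
- exists 0; first exact: idl0.
  by rewrite mul0r subr0; apply: idl0.
- move=> a b [c Qc Ha] [d Qd Hb]; exists (c + d); first exact: idlD.
  have -> : a + b - (c + d) * g = a - c * g + (b - d * g) by ring.
  exact: idlD.
- move=> a b [c Qc Hb]; exists (a * c); first exact: idlMl.
  have -> : a * b - a * c * g = a * (b - c * g) by ring.
  exact: idlMl.
Qed.

Lemma sub_qcomb Q N s : ideal_set Q -> N `<=` qcomb Q N s.
Proof.
move=> iQ; elim: s => //= g s IHs a /IHs Na; exists 0; first exact: idl0.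
by rewrite mul0r subr0.
Qed.

Lemma mem_qcomb Q N s c g : ideal_set Q -> ideal_set N ->
  Q c -> g \in s -> qcomb Q N s (c * g).
Proof.
move=> iQ iN Qc; elim: s => //= h s IHs; rewrite inE => /orP[/eqP ->|/IHs Hs].
  by exists c => //; rewrite subrr; apply: idl0; apply: qcomb_ideal.
by exists 0; [exact: idl0|rewrite mul0r subr0].
Qed.

Lemma qcomb_min Q N s V : ideal_set V -> N `<=` V ->
  (forall g, g \in s -> V g) -> qcomb Q N s `<=` V.
Proof.
move=> iV NV; elim: s => //= g s IHs sV a [c _ /IHs Hs].
apply: (idlBK iV); first by apply: Hs => h hs; apply: sV; rewrite inE hs orbT.
by apply: idlMl => //; apply: sV; rewrite mem_head.
Qed.

Lemma nakayama_seq p Q N s : prime_set p -> ideal_set Q -> ideal_set N ->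
  Q `<=` p -> (forall g, g \in s -> sat p (qcomb Q N s) g) ->
  forall g, g \in s -> sat p N g.
Proof.
move=> pp iQ iN Qp; elim: s => //= g s IHs Hs.
have [t pt [c Qc Hg]] := Hs g (mem_head _ _).
have ptc : ~ p (t - c).
  by move=> ptc; apply/pt/(idlBK (prime_ideal pp) ptc)/Qp.
have sN : forall h, h \in s -> sat p N h.
  apply: IHs => h hs; have [|u pu [d Qd Hh]] := Hs h; first by rewrite inE hs orbT.
  exists ((t - c) * u); first exact: primeM.
  have -> : (t - c) * u * h = (t - c) * (u * h - d * g) + d * (t * g - c * g) by ring.
  by apply: idlD; [exact: qcomb_ideal|apply: idlMl => //; exact: qcomb_ideal..].
move=> h; rewrite inE => /orP[/eqP ->|/sN//].
apply: (sat_id pp); exists (t - c) => //; rewrite mulrBl.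
by move: Hg; apply: qcomb_min => //; [exact: sat_ideal|exact: sub_sat].
Qed.

Definition fingen I := exists s, I = adjs [set 0] s.

Lemma nakayama p Q N M : prime_set p -> ideal_set Q -> ideal_set N ->
  fingen M -> Q `<=` p ->
  (forall a, M a -> exists2 t, ~ p t & exists2 n, N n & mulI Q M (t * a - n)) ->
  M `<=` sat p N.
Proof.
move=> pp iQ iN [s ->] Qp H.
have iC : ideal_set (qcomb Q N s) by apply: qcomb_ideal.
apply: adjs_min; first exact: sat_ideal.
  by move=> _ ->; apply: idl0; apply: sat_ideal.
apply: (nakayama_seq pp iQ iN Qp) => g gs.
have [|t pt [n Nn Hg]] := H g; first exact: (mem_adjs ideal_set0).
exists t => //; apply: (@idlBK _ _ n iC); last exact: (sub_qcomb _ iQ Nn).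
move: Hg; apply: mulI_min => // c m Qc; rewrite -/(setT _).
(* [V] is an ideal containing the generators of M, hence all of M. *)
pose V : set R := [set m | forall c, Q c -> qcomb Q N s (c * m)].
suff : adjs [set 0] s `<=` V by move=> sV /sV; apply.
apply: adjs_min.
- split=> [d _|a b Va Vb d Qd|a b Vb d Qd].
  + by rewrite mulr0; apply: idl0.
  + by rewrite mulrDr; apply: idlD; auto.
  + by rewrite mulrCA; apply: idlMl; auto.
- by move=> _ -> d _; rewrite mulr0; apply: idl0.
- by move=> h hs d Qd; apply: mem_qcomb.
Qed.

Lemma ideal_idealr I : ideal_set I -> ~ I 1 -> exists J : idealr R, [set x | x \in J] = I.
Proof.
move=> iI nI1; pose S : pred R := fun x => `[< I x >].
have SI : idealr_closed S.
  split; [by apply/asboolP; apply: idl0|by apply/negP => /asboolP|].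
  move=> a u v /asboolP Iu /asboolP Iv; apply/asboolP.
  by apply: idlD => //; apply: idlMl.
pose H := isIdealr.Build R S SI.
pose J : idealr R := HB.pack S H.
by exists J; apply/seteqP; split=> x /=; rewrite -topredE /=; [move/asboolP|move=> ?; apply/asboolP].
Qed.

Lemma idealr_ideal (J : idealr R) : ideal_set [set x | x \in J].
Proof.
by split=> /= [|a b|a b]; [exact: rpred0|exact: rpredD|exact: ring_quotient.idealMr].
Qed.

End IdealSets.

(** * Noetherian rings and the principal ideal theorem *)

Section Noetherian.
Variable R : comNzRingType.
Implicit Types (I J K M N Q U V p q : set R) (a b c x y : R).


Lemma adjs0_span (n : nat) (g : 'I_n -> R) :
  ideal_span (range g) = adjs [set 0] (codom g).
Proof.
apply/seteqP; split=> [x [m [c [h [Hh ->]]]]|].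
  apply: idl_sum => [|i]; first by apply: adjs_ideal; apply: ideal_set0.
  apply: idlMl; first by apply: adjs_ideal; apply: ideal_set0.
  have [j _ <-] := Hh i; apply: mem_adjs; first exact: ideal_set0.
  exact: codom_f.
apply: adjs_min.
- split.
  + by exists 0%N, (fun=> 0), (fun=> 0); split=> [[]//|]; rewrite big_ord0.
  + move=> _ _ [m [c [h [Hh ->]]]] [k [d [e [He ->]]]].
    exists (m + k)%N, (fun i => match split i with inl j => c j | inr j => d j end),
      (fun i => match split i with inl j => h j | inr j => e j end).
    split=> [i|]; first by case: (split i).
    rewrite big_split_ord /=; congr (_ + _); apply: eq_bigr => i _.
      by rewrite -[lshift _ _]/(unsplit (inl i)) unsplitK.
    by rewrite -[rshift _ _]/(unsplit (inr i)) unsplitK.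
  + move=> a _ [m [c [h [Hh ->]]]]; exists m, (fun i => a * c i), h; split=> //.
    by rewrite big_distrr /=; apply: eq_bigr => i _; rewrite mulrA.
- by move=> _ ->; exists 0%N, (fun=> 0), (fun=> 0); split=> [[]//|]; rewrite big_ord0.
- move=> _ /codomP[i ->]; exists 1%N, (fun=> 1), (fun=> g i); split=> [_|].
    by exists i.
  by rewrite big_ord1 mul1r.
Qed.

Hypothesis noethR : noetherian R.

Lemma noeth_fingen I : ideal_set I -> fingen I.
Proof.
move=> iI; have [I1|nI1] := pselect (I 1).
  exists [:: 1]; apply/seteqP; split=> x _.
    by rewrite -[x]mulr1; exists x; rewrite mulr1 subrr.
  by rewrite -[x]mulr1; apply: idlMl.
have [J EJ] := ideal_idealr iI nI1; have [n [g]] := noethR J.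
by rewrite EJ adjs0_span => ->; exists (codom g).
Qed.

(** A counterexample would start a strictly increasing sequence of ideals, whose union is finitely
    generated. *)
Lemma noeth_ind (H : set R -> Prop) :
  (forall U, ideal_set U ->
     (forall V, ideal_set V -> U `<=` V -> ~ V `<=` U -> H V) -> H U) ->
  forall U, ideal_set U -> H U.
Proof.
move=> IH U iU; apply: contrapT => nHU.
pose T := {V : set R | ideal_set V /\ ~ H V}.
have next (V : T) : {W : T | sval V `<=` sval W /\ ~ sval W `<=` sval V}.
  apply/cid; apply: contrapT; case: V => V [iV nHV] /= nW.
  apply: nHV; apply: (IH V iV) => W iW VW WV; apply: contrapT => nHW.
  by apply: nW; exists (exist _ W (conj iW nHW)).
pose c n : T := iter n (fun V : T => sval (next V)) (exist _ U (conj iU nHU) : T).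
have ic n : ideal_set (sval (c n)) by case: (svalP (c n)).
have cS n : sval (c n) `<=` sval (c n.+1).
  by rewrite [c n.+1]iterS; case: (svalP (next (c n))).
have cle m n : (m <= n)%N -> sval (c m) `<=` sval (c n).
  elim: n => [|n IHn]; first by rewrite leqn0 => /eqP ->.
  by rewrite leq_eqVlt => /orP[/eqP -> //|/IHn mn] x /mn /cS.
pose W : set R := [set x | exists n, sval (c n) x].
have iW : ideal_set W.
  split; first by exists 0%N; apply: idl0.
  - move=> a b [m cm] [n cn]; exists (maxn m n).
    by apply: idlD => //; [apply: cle cm|apply: cle cn]; rewrite ?leq_maxl ?leq_maxr.
  - by move=> a b [m cm]; exists m; apply: idlMl.
have [s Ws] := noeth_fingen iW.
have [n sn] : exists n, forall g, g \in s -> sval (c n) g.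
  have: forall g, g \in s -> W g by move=> g gs; rewrite Ws; apply: mem_adjs => //; apply: ideal_set0.
  elim: s {Ws} => [_|g s IHs Hs]; first by exists 0%N.
  have [|m sm] := IHs; first by move=> h hs; apply: Hs; rewrite inE hs orbT.
  have [|k gk] := Hs g; first exact: mem_head.
  exists (maxn m k) => h; rewrite inE => /orP[/eqP ->|/sm].
    by apply: cle gk; apply: leq_maxr.
  by apply: cle; apply: leq_maxl.
have [_] := svalP (next (c n)); apply => x cx.
have: W x by exists n.+1.
by rewrite Ws; apply: (adjs_min (ic n)) => // _ ->; apply: idl0.
Qed.

(** Existence of an associated prime of the localized quotient by [U]: a maximal element among the
    proper colon ideals of [sat p U] is prime. *)
Lemma ex_colon_prime p U : prime_set p -> ideal_set U -> U `<=` p ->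
  exists2 g, ~ sat p U g & prime_set [set a | sat p U (a * g)].
Proof.
move=> pp iU Up; have iS := sat_ideal pp iU.
pose C g : set R := [set a | sat p U (a * g)].
have iC g : ideal_set (C g).
  split; rewrite /C /=; first by rewrite mul0r; apply: idl0.
    by move=> a b; rewrite mulrDl; apply: idlD.
  by move=> a b; rewrite -mulrA; apply: idlMl.
suff H V : ideal_set V -> (exists2 g, ~ sat p U g & V = C g) ->
    exists2 g, ~ sat p U g & prime_set (C g).
  apply: (H (C 1)) => //; exists 1 => //; rewrite /sat /= => -[s ps].
  by rewrite mulr1 => /Up.
move: V; apply: noeth_ind => V iV IH [g Sg EV].
have [nex|] := pselect (forall h, ~ sat p U h -> C g `<=` C h -> C h `<=` C g).
  exists g => //; split=> //; rewrite /C /=; first by rewrite mul1r.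
  move=> a b; have [Sag|nSag] := pselect (sat p U (a * g)); first by left.
  rewrite -mulrA mulrCA => Sbag; right; apply: (nex (a * g)) => //.
  by move=> d Cd; rewrite /C /= mulrCA; apply: idlMl.
move=> /existsNP[h /not_implyP[Sh /not_implyP[gh hg]]].
by apply: (IH (C h)); rewrite ?EV //; exists h.
Qed.

(** When [p] is minimal over [U], the localization of R/U at [p] is Artinian, so descending chains
    are stationary in it. Noetherian induction on [U] replaces composition series: one enlarges [U]
    by a [g] spanning a simple submodule. *)
Lemma chain_stable_mod p U (I : nat -> set R) :
  prime_set p -> (forall n, ideal_set (I n)) ->
  (forall m n, (m <= n)%N -> I n `<=` I m) ->
  (forall q, prime_set q -> U `<=` q -> q `<=` p -> p `<=` q) -> ideal_set U ->
  exists n, forall m a, (n <= m)%N -> I n a ->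
    exists2 s, ~ p s & exists2 b, I m b & U (s * a - b).
Proof.
move=> pp iI Ile Hq iU; move: U iU Hq; apply: noeth_ind => U iU IH Hq.
have iS := sat_ideal pp iU.
have [Up|/existsNP[u /not_implyP[Uu pu]]] := pselect (U `<=` p); last first.
  exists 0%N => m a _ _; exists u => //; exists 0; first exact: idl0.
  by rewrite subr0; apply: idlMr.
have [g Sg primeC] := ex_colon_prime pp iU Up.
(* The annihilator of [g] modulo [U] is a prime between [U] and [p], hence [p] by minimality:
   locally, [g] spans a simple module. *)
have pC a : p a -> sat p U (a * g).
  apply: (Hq _ primeC) => [b Ub|b [s ps Ub]]; first by apply: (sub_sat pp); apply: idlMr.
  apply: contrapT => pb; apply: Sg; exists (s * b); first exact: primeM.
  by rewrite -mulrA.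
have [n0 Hn0] : exists n, forall m a, (n <= m)%N -> I n a ->
    exists2 s, ~ p s & exists2 b, I m b & adj U g (s * a - b).
  apply: IH; first exact: adj_ideal.
  - exact: sub_adj.
  - by move=> H; apply: Sg; apply: (sub_sat pp); apply: H; apply: mem_adj.
  - by move=> q qq Uq qp; apply: Hq => // x Ux; apply/Uq/sub_adj.
have [Hg|] := pselect (forall k, exists2 s, ~ p s & exists2 b, I k b & U (s * g - b)).
  exists n0 => m a nm Ia; have [s ps [b Ib [c Hc]]] := Hn0 m a nm Ia.
  have [t pt [d Id Hd]] := Hg m; exists (t * s); first exact: primeM.
  exists (t * b + c * d); first by apply: idlD => //; apply: idlMl.
  have -> : t * s * a - (t * b + c * d) = t * (s * a - b - c * g) + c * (t * g - d) by ring.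
  by apply: idlD => //; apply: idlMl.
move=> /existsNP[k Hk].
(* As [I k] does not contain [g] modulo [U], it meets the simple module spanned by [g] only in 0. *)
have Ck x c : I k x -> sat p U (x - c * g) -> sat p U x.
  move=> Ix Sx; have [pc|pc] := pselect (p c).
    by apply: (idlBK iS Sx); apply: pC.
  case: Hk; have [s ps Us] := Sx; exists (s * c); first exact: primeM.
  exists (s * x); first exact: idlMl.
  have -> : s * c * g - s * x = - (s * (x - c * g)) by ring.
  exact: idlN.
exists (maxn n0 k) => m a; rewrite geq_max => /andP[nm km] Ia.
have [s ps [b Ib [c Hc]]] := Hn0 m a nm (Ile _ _ (leq_maxl _ _) _ Ia).
have [||t pt Ut] := Ck (s * a - b) c.
- by apply: idlB => //; [apply: idlMl => //; apply: Ile Ia; apply: leq_maxr|apply: Ile Ib].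
- exact: sub_sat.
exists (t * s); first exact: primeM.
exists (t * b); first exact: idlMl.
by rewrite -mulrA -mulrBr.
Qed.

(* If every prime between [p0 + (x)] and [p2] were [p2], the symbolic powers  *)
(* of [p1] would be stationary modulo [x], hence stationary by Nakayama, hence *)
(* zero modulo [p0] by Nakayama at [p1]. *)
Lemma krull_pit p0 p1 p2 x : prime_set p0 -> prime_set p1 -> prime_set p2 ->
  p0 `<` p1 -> p1 `<` p2 -> p2 x ->
  exists p', [/\ prime_set p', p0 `<` p', p' `<` p2 & p' x].
Proof.
move=> p0P p1P p2P [p01 n10] [p12 n21] xp2; apply: contrapT => nex.
have [[i0 i1] i2] := (prime_ideal p0P, prime_ideal p1P, prime_ideal p2P).
have xp1 : ~ p1 x by move=> x1; apply: nex; exists p1; split; [|split|split|].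
(* The n-th symbolic power of [p1] modulo [p0]. *)
pose I n := sat p1 [set a | exists2 b, p0 b & ipow p1 n (a - b)].
have iJ n : ideal_set [set a | exists2 b, p0 b & ipow p1 n (a - b)].
  have iP := ipow_ideal n i1; split=> /=.
  - by exists 0; [exact: idl0|rewrite subrr; exact: idl0].
  - move=> a b [c pc Ha] [d pd Hb]; exists (c + d); first exact: idlD.
    by rewrite opprD addrACA; apply: idlD.
  - move=> a b [c pc Hb]; exists (a * c); first exact: idlMl.
    by rewrite -mulrBr; apply: idlMl.
have iI n : ideal_set (I n) by apply: sat_ideal.
have p0I n : p0 `<=` I n.
  move=> a pa; apply: sub_sat => //; exists a => //; rewrite subrr.
  by apply: idl0; apply: ipow_ideal.
have IS n : I n.+1 `<=` I n.
  by apply: sat_mono => a [b pb Hb]; exists b => //; apply: ipowS.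
have Ile m n : (m <= n)%N -> I n `<=` I m.
  elim: n => [|n IHn]; first by rewrite leqn0 => /eqP ->.
  by rewrite leq_eqVlt => /orP[/eqP -> //|/IHn mn] a /IS /mn.
have [|n Hn] := chain_stable_mod p2P iI Ile _ (adj_ideal x i0).
  move=> q qP p0q qp2 a pa; apply: contrapT => nqa; apply: nex; exists q.
  split=> //; last by apply: p0q; apply: mem_adj.
    split; first by move=> b pb; apply: p0q; apply: sub_adj.
    by move=> qp0; apply: xp1; apply: p01; apply: qp0; apply: p0q; apply: mem_adj.
  by split=> // H; apply: nqa; apply: H.
have In : I n `<=` sat p2 (I n.+1).
  apply: (@nakayama _ _ (adj [set 0] x)) => //.
  - by apply: adj_ideal; apply: ideal_set0.
  - exact: noeth_fingen.
  - by apply: adj_min => // _ ->; apply: idl0.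
  move=> a Ia; have [s ps [b Ib [c Hc]]] := Hn n.+1 a (leqnSn _) Ia.
  exists s => //; exists (b + (s * a - b - c * x)).
    by apply: idlD => //; apply: p0I.
  have -> : s * a - (b + (s * a - b - c * x)) = x * c by ring.
  apply: mem_mulI; first by apply: mem_adj; apply: ideal_set0.
  (* Since [x] is outside [p1] and [I n] is saturated at [p1], the membership of c x gives that of
     c; the remainder therefore lies in (x) times [I n], as Nakayama requires. *)
  have [t pt Ht] : I n (c * x).
    have -> : c * x = s * a - b - (s * a - b - c * x) by ring.
    apply: idlB => //; last exact: p0I.
    by apply: idlB => //; [exact: idlMl|exact: IS].
  by exists (t * x); [exact: primeM|rewrite -mulrA [x * c]mulrC].
have n0 : ipow p1 n `<=` sat p1 p0.
  apply: (@nakayama _ _ p1) => //.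
    by apply: noeth_fingen; apply: ipow_ideal.
  move=> a Ha; have [s ps] : sat p2 (I n.+1) a.
    by apply/In/sub_sat => //; exists 0; [exact: idl0|rewrite subr0].
  by case=> t pt [b pb Hb]; exists (t * s) => //; [apply: primeM => // /p12|exists b; rewrite -?mulrA].
apply: n10 => a pa; have /n0[s ps] : ipow p1 n (a ^+ n).
  elim: n {n0 In Hn} => [|n IHn] //; rewrite exprS; exact: mem_mulI.
case: (p0P) => _ _ p0M /p0M[/p01//|].
elim: n {n0 In Hn} => [|n IHn]; first by rewrite expr0; case: p0P.
by rewrite exprS => /p0M[].
Qed.

End Noetherian.

(** * Chains of primes and regularity of a localized quotient *)

Section Chains.
Variable R : comNzRingType.
Implicit Types (I J K M N Q U V p q : set R) (a b c x y : R).

(** Both ends of the chain are recorded: the lower one is to be compared with ideals, and chains are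
    to be concatenated. *)
Fixpoint pchain n (Q0 Q : set R) : Prop :=
  if n is n'.+1 then exists Q', [/\ pchain n' Q0 Q', Q' `<` Q & prime_set Q]
  else Q0 = Q /\ prime_set Q.

Lemma pchain_prime n Q0 Q : pchain n Q0 Q -> prime_set Q.
Proof. by case: n => [[]|n [Q' []]]. Qed.

Lemma pchain_prime0 n Q0 Q : pchain n Q0 Q -> prime_set Q0.
Proof. by elim: n Q => [Q [->]|n IHn Q [Q' [/IHn]]]. Qed.

Lemma pchain_sub n Q0 Q : pchain n Q0 Q -> Q0 `<=` Q.
Proof.
elim: n Q => [Q [-> _] //|n IHn Q [Q' [/IHn H [H' _] _]]].
by move=> x /H /H'.
Qed.

Lemma pchain_cat m n Q0 Q1 Q2 :
  pchain m Q0 Q1 -> pchain n Q1 Q2 -> pchain (m + n) Q0 Q2.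
Proof.
move=> H; elim: n Q2 => [Q2 [<- _]|n IHn Q2 [Q' [/IHn H1 H2 H3]]]; first by rewrite addn0.
by rewrite addnS; exists Q'.
Qed.

Lemma pchain1 Q0 Q : prime_set Q0 -> prime_set Q -> Q0 `<` Q -> pchain 1 Q0 Q.
Proof. by move=> *; exists Q0. Qed.

Lemma pchain_drop m n Q0 Q : (m <= n)%N -> pchain n Q0 Q -> exists Q1, pchain m Q1 Q.
Proof.
elim: n m Q => [|n IHn] [|m] Q // mn H; first by exists Q0.
  by exists Q; split=> //; exact: pchain_prime H.
by have [Q' [/(IHn _ _ mn)[Q1 H1] H2 H3]] := H; exists Q1, Q'.
Qed.

(** Only a chain of length 0 has to move its lower end. *)
Lemma pchain_widen n Q0 Q Q' : prime_set Q' -> Q `<=` Q' -> pchain n Q0 Q ->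
  exists2 Q1, Q0 `<=` Q1 & pchain n Q1 Q'.
Proof.
case: n => [|n] pQ' QQ'; first by move=> [-> _]; exists Q'.
move=> [Q1 [H1 [H2 H3] _]]; exists Q0 => //; exists Q1; split=> //; split=> [x /H2 /QQ'//|].
by move=> H; apply: H3 => x /QQ' /H.
Qed.

(** Dividing by one element lowers the dimension by at most one. If the prime below the top misses
    [x], [krull_pit] replaces it by one that contains [x], and one descends until the bottom step is
    given up. *)
Lemma pchain_through n Q0 Q x : noetherian R -> pchain n.+1 Q0 Q -> Q x ->
  exists Q1, [/\ Q0 `<=` Q1, Q1 x & pchain n Q1 Q].
Proof.
move=> noethR; elim: n Q => [|n IHn] Q.
  by move=> [_ [[<- _] [Q0Q _] pQ]] Qx; exists Q.
move=> [Q' [H [Q'Q nQ] pQ]] Qx; have [Q'x|nQ'x] := pselect (Q' x).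
  by have [Q1 [H1 H2 H3]] := IHn _ H Q'x; exists Q1; split=> //; exists Q'.
case: H => Q'' [H Q''Q' pQ'].
have [p' [pp' H1 H2 p'x]] :=
  krull_pit noethR (pchain_prime H) pQ' pQ Q''Q' (conj Q'Q nQ) Qx.
have [|Q1 [H3 H4 H5]] := IHn p' _ p'x; first by exists Q''.
by exists Q1; split=> //; exists p'.
Qed.

End Chains.

(** * Regular local rings: dimension, cotangent space, quotients *)

Section Regular.
Variables (R : comNzRingType) (P : set R).
Hypotheses (noethR : noetherian R) (pP : prime_set P).
Implicit Types (I J K M N Q U V p q : set R) (a b c x y : R) (s : seq R).

Let iP := prime_ideal pP.

Definition dim_ge K n := exists2 Q0, K `<=` Q0 & pchain n Q0 P.

Definition local_gens K s :=
  (forall x, x \in s -> P x) /\ P `<=` sat P (adjs K s).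

(* The local ring of [R / K] at [P] is regular of dimension [d]. *)
Definition regular_at K d :=
  (exists2 s, size s = d & local_gens K s) /\ dim_ge K d.

Lemma dim_ge_adj K d x : dim_ge K d.+1 -> P x -> dim_ge (adj K x) d.
Proof.
move=> [Q0 KQ0 H] Px; have [Q1 [Q01 Q1x H1]] := pchain_through noethR H Px.
exists Q1 => //; apply: adj_min => //; first exact/prime_ideal/(pchain_prime0 H1).
by move=> y /KQ0 /Q01.
Qed.

(** Each generator lowers the dimension by at most one, and without generators [P] is the only prime
    left. *)
Lemma dim_le_gens K s d : local_gens K s -> dim_ge K d -> (d <= size s)%N.
Proof.
elim: s K d => [|g s IHs] K [|d] //= [sP PK].
  move=> [Q0 KQ0 [Q' [H [Q'P nPQ'] _]]]; case: nPQ' => x /PK.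
  apply: sat_sub_prime => //; first exact: pchain_prime H.
  by move=> y /KQ0; apply: (pchain_sub H).
move=> H; apply: (IHs (adj K g)).
  by split=> // x xs; apply: sP; rewrite inE xs orbT.
by apply: dim_ge_adj => //; apply: sP; rewrite mem_head.
Qed.

(** A regular local ring is a domain. A generator g is not in [Q0], for otherwise d - 1 generators
    would suffice in dimension d. By induction [Q0] lies locally in K + (g), and g-multiples in the
    prime [Q0] have their cofactor in [Q0]; so Q0 = K + g Q0 locally, and Nakayama applies. *)
Lemma regular_at_sub K d Q0 : ideal_set K -> regular_at K d -> K `<=` Q0 ->
  pchain d Q0 P -> Q0 `<=` sat P K.
Proof.
elim: d K Q0 => [|d IHd] K Q0 iK [[s sz [sP PK]] _] KQ0 H.
  by case: H => -> _; case: s sz PK {sP}.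
case: s sz sP PK => //= g s [sz] sP PK.
have Pg : P g by apply: sP; rewrite mem_head.
have Hg : local_gens (adj K g) s.
  by split=> // x xs; apply: sP; rewrite inE xs orbT.
have pQ0 := pchain_prime0 H; have iQ0 := prime_ideal pQ0.
have nQ0g : ~ Q0 g.
  move=> Q0g; suff /(dim_le_gens Hg) : dim_ge (adj K g) d.+1 by rewrite sz ltnn.
  by exists Q0 => //; apply: adj_min.
have [Q1 [Q01 Q1g H1]] := pchain_through noethR H Pg.
have KQ1 : adj K g `<=` Q1.
  apply: adj_min => //; first exact/prime_ideal/(pchain_prime0 H1).
  by move=> y /KQ0 /Q01.
have Q1K : Q1 `<=` sat P (adj K g).
  apply: IHd => //; first exact: adj_ideal.
  by split; [exists s|exists Q1].
apply: (@nakayama _ _ (adj [set 0] g)) => //.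
- by apply: adj_ideal; apply: ideal_set0.
- exact: noeth_fingen.
- by apply: adj_min => // _ ->; apply: idl0.
move=> a Qa; have [t pt [c Kc]] := Q1K _ (Q01 _ Qa).
exists t => //; exists (t * a - c * g) => //.
have -> : t * a - (t * a - c * g) = g * c by ring.
apply: mem_mulI; first by apply: mem_adj; apply: ideal_set0.
have [_ _ Q0M] := pQ0; case: (Q0M c g) => // .
have -> : c * g = t * a - (t * a - c * g) by ring.
by apply: idlB => //; [apply: idlMl|apply: KQ0].
Qed.

Lemma regular_at_chain K d : ideal_set K -> regular_at K d -> pchain d (sat P K) P.
Proof.
move=> iK H; have [_ [Q0 KQ0 HQ0]] := H.
suff <- : Q0 = sat P K by [].
apply/seteqP; split; first exact: regular_at_sub H KQ0 HQ0.
by apply: sat_sub_prime => //; [exact: pchain_prime0 HQ0|exact: pchain_sub HQ0].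
Qed.

Definition addsq K : set R := [set a | exists2 k, K k & mulI P P (a - k)].

Lemma addsq_ideal K : ideal_set K -> ideal_set (addsq K).
Proof.
move=> iK; have iS := mulI_ideal P iP; split=> /=.
- by exists 0; [exact: idl0|rewrite subrr; exact: idl0].
- move=> a b [k Kk Ha] [l Kl Hb]; exists (k + l); first exact: idlD.
  by rewrite opprD addrACA; apply: idlD.
- move=> a b [k Kk Hb]; exists (a * k); first exact: idlMl.
  by rewrite -mulrBr; apply: idlMl.
Qed.

Lemma sub_addsq K : K `<=` addsq K.
Proof. by move=> a Ka; exists a => //; rewrite subrr; apply: idl0; apply: mulI_ideal. Qed.

Lemma mul_addsq K a b : ideal_set K -> P a -> P b -> addsq K (a * b).
Proof. by move=> iK Pa Pb; exists 0; [exact: idl0|rewrite subr0; apply: mem_mulI]. Qed.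

Lemma addsq_mono K N : K `<=` N -> addsq K `<=` addsq N.
Proof. by move=> KN a [k /KN Nk Ha]; exists k. Qed.

Lemma adjs_cons K g s : ideal_set K -> adjs K (g :: s) `<=` adj (adjs K s) g.
Proof.
move=> iK; have iKs := adjs_ideal s iK.
apply: adjs_min; first exact: adj_ideal.
  by move=> x Kx; apply: sub_adj; apply: sub_adjs.
move=> h; rewrite inE => /orP[/eqP ->|hs]; first exact: mem_adj.
by apply: sub_adj; apply: mem_adjs.
Qed.

(** Steinitz exchange over a local ring: as [y] is outside [N], some generator occurs in it with a
    coefficient outside [P], and [y] can take its place. *)
Lemma adjs_exchange K N s y : ideal_set K -> ideal_set N -> K `<=` N ->
  (forall c g, P c -> g \in s -> N (c * g)) -> adjs K s y -> ~ N y ->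
  exists s', [/\ size s = (size s').+1, {subset s' <= s} &
                 adjs K s `<=` sat P (adjs (adj K y) s')].
Proof.
move=> iK iN KN; elim: s y => [|g s IHs] y Hs; first by move=> /KN.
move=> /(adjs_cons iK)[c Hy] nNy.
have [Pc|nPc] := pselect (P c); last first.
  have iA := adjs_ideal s (adj_ideal y iK).
  exists s; split=> //; first by move=> x xs; rewrite inE xs orbT.
  apply: adjs_min; first exact: sat_ideal.
    by move=> x Kx; apply: sub_sat => //; apply: sub_adjs; apply: sub_adj.
  move=> h; rewrite inE => /orP[/eqP ->|hs]; last first.
    by apply: sub_sat => //; apply: mem_adjs => //; apply: adj_ideal.
  exists c => //; have -> : c * g = y - (y - c * g) by ring.
  apply: idlB => //; first by apply: sub_adjs; apply: mem_adj.
  by move: Hy; apply: adjs_mono; [exact: adj_ideal|exact: sub_adj].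
have [||s' [sz ss' H]] := IHs (y - c * g) _ Hy.
- by move=> d h Pd hs; apply: Hs => //; rewrite inE hs orbT.
- by move=> Ny; apply: nNy; apply: (idlBK iN Ny); apply: Hs => //; rewrite mem_head.
exists (g :: s'); split; first by rewrite /= sz.
  by move=> h; rewrite !inE => /orP[->//|/ss' ->]; rewrite orbT.
have iA := adjs_ideal (g :: s') (adj_ideal y iK).
have Ag : adjs (adj K y) (g :: s') g by apply: mem_adjs; [exact: adj_ideal|exact: mem_head].
apply: adjs_min; first exact: sat_ideal.
  by move=> x Kx; apply: sub_sat => //; apply: sub_adjs; apply: sub_adj.
move=> h; rewrite inE => /orP[/eqP ->|hs]; first by apply: sub_sat.
have [t pt Ht] : sat P (adjs (adj K (y - c * g)) s') h by apply: H; apply: mem_adjs.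
exists t => //; move: Ht; apply: adjs_min => //; last first.
  move=> x xs; apply: mem_adjs; first exact: adj_ideal.
  by rewrite inE xs orbT.
apply: adj_min => //; first by move=> x Kx; apply: sub_adjs; apply: sub_adj.
apply: idlB => //; last exact: idlMl.
by apply: sub_adjs; apply: mem_adj.
Qed.

(** An element that is nonzero in the cotangent space belongs to a minimal system of generators, so
    the quotient by it has one generator fewer; its dimension drops by exactly one. *)
Lemma regular_at_adj K d x : ideal_set K -> regular_at K d -> P x ->
  ~ sat P (addsq K) x ->
  exists2 e, d = e.+1 & regular_at (adj K x) e /\ sat P K `<` sat P (adj K x).
Proof.
move=> iK reg Px nx; have [[s sz [sP PK]] dimK] := reg.
have [t pt Hx] := PK x Px.
have [|||||s' [sz' ss' H]] := @adjs_exchange K (addsq K) s (t * x) _ _ _ _ Hx.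
- by [].
- exact: addsq_ideal.
- exact: sub_addsq.
- by move=> c g Pc /sP Pg; apply: mul_addsq.
- by move=> H; apply: nx; exists t.
have gens' : local_gens (adj K x) s'.
  split=> [y /ss' /sP//|y /PK]; move: y; apply: sat_min => // y /H.
  apply: sat_mono; apply: adjs_mono; first exact: adj_ideal.
  apply: adj_min; [exact: adj_ideal|exact: sub_adj|].
  by apply: idlMl; [exact: adj_ideal|exact: mem_adj].
rewrite -sz sz' in dimK reg *; exists (size s') => //.
split; first by split; [exists s'|apply: dim_ge_adj].
split; first by apply: sat_mono; apply: sub_adj.
move=> H1; suff /(dim_le_gens gens') : dim_ge (adj K x) (size s').+1 by rewrite ltnn.
exists (sat P K); last exact: regular_at_chain.
by move=> y xy; apply: H1; apply: sub_sat.
Qed.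

(** Linear independence in the cotangent space of R/K at [P], phrased one element at a time to match
    the successive quotients. *)
Fixpoint indep_at K s : Prop :=
  if s is x :: s' then ~ sat P (addsq K) x /\ indep_at (adj K x) s' else True.

Lemma regular_at_adjs K d s : ideal_set K -> regular_at K d ->
  (forall x, x \in s -> P x) -> indep_at K s ->
  [/\ (size s <= d)%N, regular_at (adjs K s) (d - size s) &
      pchain (size s) (sat P K) (sat P (adjs K s))].
Proof.
elim: s K d => [|x s IHs] K d iK reg sP.
  by move=> _; rewrite /= subn0; split=> //; split=> //; apply: pchain_prime0 (regular_at_chain iK reg).
move=> [nx ind]; have Px : P x by apply: sP; rewrite mem_head.
have [e -> [reg' lt']] := regular_at_adj iK reg Px nx.
have [||||H1 H2 H3] := IHs (adj K x) e => //; first exact: adj_ideal.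
  by move=> y ys; apply: sP; rewrite inE ys orbT.
rewrite -[size (x :: s)]/(size s).+1 subSS; split=> //; rewrite -add1n; apply: pchain_cat H3; apply: pchain1 => //.
  exact: pchain_prime0 (regular_at_chain iK reg).
by apply: pchain_prime0 (regular_at_chain _ reg'); apply: adj_ideal.
Qed.

(** Here [r] is the height of J at [P], given by its lower bound for all primes over J and a prime
    [Q] attaining it. The list [s] is a basis of the image of J in the cotangent space, and
    everything follows by comparing J with the prime [q] that [s] generates locally. *)
Lemma regular_quotient_criterion J d r s :
  ideal_set J -> J `<=` P -> regular_at [set 0] d ->
  (forall x, x \in s -> J x) -> indep_at [set 0] s ->
  J `<=` sat P (addsq (adjs [set 0] s)) ->
  (forall Q, prime_set Q -> J `<=` Q -> Q `<=` P -> exists Q0, pchain r Q0 Q) ->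
  (exists Q, [/\ prime_set Q, J `<=` Q, Q `<=` P & forall Q0, ~ pchain r.+1 Q0 Q]) ->
  (size s <= r)%N /\ ((exists e, regular_at J e) <-> size s = r).
Proof.
move=> iJ JP reg0 sJ ind HJ ht_ge [Q [pQ JQ QP ht_lt]].
have i0 := ideal_set0 R; have is0 := adjs_ideal s i0.
have [|sd regs chs] := regular_at_adjs i0 reg0 _ ind; first by move=> x /sJ /JP.
pose q := sat P (adjs [set 0] s); have pq : prime_set q := pchain_prime chs.
have sub_q U : ideal_set U -> J `<=` U -> adjs [set 0] s `<=` U.
  by move=> iU JU; apply: adjs_min => // [_ ->|x /sJ /JU//]; apply: idl0.
have qQ : q `<=` Q by apply: sat_sub_prime => //; apply: sub_q => //; apply: prime_ideal.
have s_le_r : (size s <= r)%N.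
  rewrite leqNgt; apply/negP => rs.
  have [Q1 _ /(pchain_drop rs)[Q2]] := pchain_widen pQ qQ chs.
  exact: ht_lt.
split=> //; split=> [[e regJ]|sr]; last first.
  have Jq : J `<=` q.
    (* If J were not in [q], then [Q] would strictly contain [q], and the chain of length [size s] =
       [r] up to [q] would extend to one of length r + 1 up to [Q]. *)
    apply: contrapT => nJq; apply: (ht_lt (sat P [set 0])).
    rewrite -addn1 -sr; apply: pchain_cat chs _; apply: pchain1 => //.
    by split=> // Qq; apply: nJq => x /JQ /Qq.
  exists (d - size s)%N; have [[s' sz [s'P Ps']] _] := regs.
  split; last by exists q => //; exact: regular_at_chain.
  exists s' => //; split=> // x /Ps'; apply: sat_min => // y.
  have iJs := adjs_ideal s' iJ; apply: adjs_min; first exact: sat_ideal.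
    apply: sub_q; first exact: sat_ideal.
    by move=> z Jz; apply: sub_sat => //; apply: sub_adjs.
  by move=> z zs; apply: sub_sat => //; apply: mem_adjs.
have [[s' sz [s'P Ps']] _] := regJ.
(* Together, [s] and lifts of generators for R/J generate [P] modulo its square, hence locally by
   Nakayama. *)
have de : (d <= size s + e)%N.
  rewrite -sz -size_cat; apply: (@dim_le_gens [set 0]); last by case: reg0.
  pose N := adjs [set 0] (s ++ s'); have iN : ideal_set N by apply: adjs_ideal.
  split; first by move=> x; rewrite mem_cat => /orP[/sJ /JP|/s'P].
  apply: (@nakayama _ _ P) => //; first exact: noeth_fingen.
  suff HP : P `<=` sat P (addsq N) by move=> a /HP[t pt]; exists t.
  move=> x /Ps'; apply: sat_min => // {}x; apply: adjs_min.
  - by apply: sat_ideal => //; apply: addsq_ideal.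
  - move=> y /HJ; apply: sat_mono; apply: addsq_mono; apply: adjs_min => //.
      by move=> _ ->; apply: idl0.
    by move=> z zs; apply: mem_adjs => //; rewrite mem_cat zs.
  - move=> y ys; apply: sub_sat => //; apply: sub_addsq; apply: mem_adjs => //.
    by rewrite mem_cat ys orbT.
have chJ := regular_at_chain iJ regJ.
have Jq : sat P J `<=` q.
  (* Otherwise the quotient by [q] would have dimension at least e + 1, although d - [size s] <=
     e. *)
  apply: contrapT => nJq; have : dim_ge (adjs [set 0] s) e.+1.
    exists q; first exact: sub_sat.
    rewrite -add1n; apply: (pchain_cat _ chJ); apply: pchain1 => //.
      exact: pchain_prime0 chJ.
    by split=> //; apply: sat_mono; apply: sub_q.
  have [[s'' sz'' gens''] _] := regs; move=> /(dim_le_gens gens'').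
  by rewrite sz'' leq_subRL // => H; move: de; rewrite leqNgt -addnS H.
have Eq : sat P J = q.
  by apply/seteqP; split=> //; apply: sat_mono; apply: sub_q.
have [|||Q0 HQ0] := ht_ge q; first by [].
- by rewrite -Eq; apply: sub_sat.
- exact: pchain_sub (regular_at_chain is0 regs).
rewrite Eq in chJ.
(* A chain of length [r] below [q] continues with the chain of length [e] from [q] to [P]. *)
have : (r + e <= d)%N.
  have [[s0 sz0 gens0] _] := reg0; rewrite -sz0; apply: (dim_le_gens gens0).
  exists Q0; last exact: pchain_cat HQ0 chJ.
  by move=> _ ->; apply: idl0; apply: prime_ideal; apply: pchain_prime0 HQ0.
move=> rd; apply/eqP; rewrite eqn_leq s_le_r /= -(leq_add2r e).
exact: leq_trans rd de.
Qed.

End Regular.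

(** * Ideals of a localized quotient *)

Lemma prime_set_idealr (R : comNzRingType) (q : set R) : prime_set q ->
  exists Q : prime_idealr R, [set x | x \in Q] = q.
Proof.
move=> [iq q1 qM]; pose S : pred R := fun x => `[< q x >].
have SI : idealr_closed S.
  split; [by apply/asboolP; apply: idl0|by apply/negP => /asboolP|].
  move=> a u v /asboolP qu /asboolP qv; apply/asboolP.
  by apply: idlD => //; apply: idlMl.
have SP : prime_idealr_closed S.
  by move=> u v /asboolP /qM[qu|qv]; apply/orP; [left|right]; apply/asboolP.
pose HI := isIdealr.Build R S SI.
pose HP := isPrimeIdealrClosed.Build R S SP.
pose Q : prime_idealr R := HB.pack S HI HP.
by exists Q; apply/seteqP; split=> x /=; rewrite -topredE /=; [move/asboolP|move=> ?; apply/asboolP].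
Qed.

Lemma idealr_prime_set (R : comNzRingType) (Q : prime_idealr R) :
  prime_set [set x | x \in Q].
Proof.
split=> [||a b /=]; first exact: idealr_ideal.
  by rewrite /= idealr1.
by rewrite prime_idealrM => /orP.
Qed.

Lemma height_geP (R : comNzRingType) (Q : prime_idealr R) n :
  height_ge Q n <-> exists Q0, pchain n Q0 [set x | x \in Q].
Proof.
split=> [[q [qn qlt]]|[Q0]].
  exists [set x | x \in q 0%N].
  have -> : [set x | x \in Q] = [set x | x \in q n].
    by apply/seteqP; split=> x /=; rewrite qn.
  elim: n {qn} qlt => [|n IHn] qlt; first by split=> //; apply: idealr_prime_set.
  exists [set x | x \in q n]; split; last exact: idealr_prime_set.
    by apply: IHn => i ni; apply: qlt; apply: ltnW.
  by have [] := qlt n (ltnSn n).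
elim: n Q => [|n IHn] Q.
  by move=> _; exists (fun=> Q).
move=> [Q' [H [Q'Q nQ] _]].
have [q' Eq'] := prime_set_idealr (pchain_prime H).
have [|q [qn qlt]] := IHn q'; first by rewrite Eq'.
exists (fun i => if (i <= n)%N then q i else Q); split; first by rewrite ltnn.
move=> i; rewrite ltnS => lin; rewrite lin.
have [ltin|] := boolP (i < n)%N; first exact: qlt.
rewrite -leqNgt => leni; have -> : i = n by apply/eqP; rewrite eqn_leq lin.
have Q'E x : (x \in q n) = (x \in q') by rewrite qn.
have Q'P x : x \in q' <-> Q' x by rewrite -Eq'.
split=> [x|H1]; first by rewrite Q'E => /Q'P /Q'Q.
by apply: nQ => x /H1; rewrite Q'E => /Q'P.
Qed.

(** * Contraction and extension along A -> (A/K)_P *)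

Section Transfer.
Variables (A L : comNzRingType) (phi : {rmorphism A -> L}) (P K : set A).
Hypotheses (noethA : noetherian A) (pP : prime_set P) (iK : ideal_set K).
Hypothesis KP : K `<=` P.
(** These three hypotheses characterize [phi] as the localization at [P] of the quotient by [K].
    They allow A_P and the localization of C to be treated at once. *)
Hypothesis phi_frac : forall z, exists a s, ~ P s /\ phi s * z = phi a.
Hypothesis phi_unit : forall s, ~ P s -> exists t, t * phi s = 1.
Hypothesis phi_ker : forall a, phi a = 0 <-> sat P K a.

Let iP := prime_ideal pP.

Definition pre (Q : set L) : set A := phi @^-1` Q.

Definition ext (q : set A) : set L :=
  [set z | exists a s, [/\ ~ P s, q a & phi s * z = phi a]].

Lemma pre_ideal Q : ideal_set Q -> ideal_set (pre Q).
Proof.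
move=> iQ; rewrite /pre; split=> [|a b|a b] /=.
- by rewrite rmorph0; apply: idl0.
- by rewrite rmorphD; apply: idlD.
- by rewrite rmorphM; apply: idlMl.
Qed.

Lemma sub_pre Q : ideal_set Q -> K `<=` pre Q.
Proof.
move=> iQ a Ka; rewrite /pre /=; have -> : phi a = 0; last exact: idl0.
by apply/phi_ker; apply: sub_sat.
Qed.

Lemma pre_sub Q : ideal_set Q -> ~ Q 1 -> pre Q `<=` P.
Proof.
move=> iQ Q1 s Qs; apply: contrapT => /phi_unit[t Et].
by apply: Q1; rewrite -Et; apply: idlMl.
Qed.

Lemma pre_prime Q : prime_set Q -> prime_set (pre Q).
Proof.
move=> [iQ Q1 QM]; split; first exact: pre_ideal.
  by rewrite /pre /= rmorph1.
by move=> a b; rewrite /pre /= rmorphM; apply: QM.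
Qed.

Lemma mem_pre Q a s z : ideal_set Q -> ~ P s -> phi s * z = phi a -> pre Q a <-> Q z.
Proof.
move=> iQ /phi_unit[t Et] E; rewrite /pre /= -E; split; last exact: idlMl.
by move=> H; rewrite -[z]mul1r -Et -mulrA; apply: idlMl.
Qed.

Lemma pre_mono Q Q' : ideal_set Q -> ideal_set Q' ->
  pre Q `<=` pre Q' -> Q `<=` Q'.
Proof.
move=> iQ iQ' H z Qz; have [a [s [Ps E]]] := phi_frac z.
by apply/(mem_pre iQ' Ps E); apply: H; apply/(mem_pre iQ Ps E).
Qed.

Lemma pre_proper Q Q' : ideal_set Q -> ideal_set Q' ->
  Q `<` Q' <-> pre Q `<` pre Q'.
Proof.
move=> iQ iQ'; split=> -[QQ nQ]; split.
- by move=> a; apply: QQ.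
- by move=> H; apply: nQ; apply: pre_mono.
- exact: pre_mono.
- by move=> H; apply: nQ => a; apply: H.
Qed.

Lemma phi_eq a b : phi a = phi b -> exists2 t, ~ P t & K (t * (a - b)).
Proof.
move=> E; have /phi_ker[t Pt Kt] : phi (a - b) = 0 by rewrite rmorphB E subrr.
by exists t.
Qed.

Lemma ext_ideal q : ideal_set q -> ideal_set (ext q).
Proof.
move=> iq; split.
- exists 0, 1; split; [by case: pP|exact: idl0|by rewrite rmorph0 mulr0].
- move=> y z [a [s [Ps qa Ea]]] [b [t [Pt qb Eb]]].
  exists (t * a + s * b), (s * t); split; first exact: primeM.
    by apply: idlD => //; apply: idlMl.
  rewrite rmorphD !rmorphM -Ea -Eb; ring.
- move=> y z [a [s [Ps qa Ea]]]; have [b [t [Pt Eb]]] := phi_frac y.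
  exists (b * a), (s * t); split; [exact: primeM|exact: idlMl|].
  rewrite !rmorphM -Ea -Eb; ring.
Qed.

Lemma mem_ext q a : prime_set q -> K `<=` q -> q `<=` P -> ext q (phi a) <-> q a.
Proof.
move=> pq Kq qP; have iq := prime_ideal pq; split=> [|qa]; last first.
  by exists a, 1; split=> //; [case: pP|rewrite rmorph1 mul1r].
move=> [b [s [Ps qb]]]; rewrite -rmorphM => /phi_eq[t Pt /Kq].
case: (pq) => _ _ qM /qM[/qP//|H]; have : q (s * a) by apply: idlBK H qb.
by move=> /qM[/qP|].
Qed.

Lemma pre_ext q : prime_set q -> K `<=` q -> q `<=` P -> pre (ext q) = q.
Proof. by move=> pq Kq qP; apply/seteqP; split=> a /(mem_ext a pq Kq qP). Qed.

Lemma ext_prime q : prime_set q -> K `<=` q -> q `<=` P -> prime_set (ext q).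
Proof.
move=> pq Kq qP; have iq := prime_ideal pq; have ie := ext_ideal iq.
have E := pre_ext pq Kq qP; split=> //.
  by rewrite -(rmorph1 phi) => /(mem_ext 1 pq Kq qP); case: pq.
move=> y z; have [a [s [Ps Ea]]] := phi_frac y; have [b [t [Pt Eb]]] := phi_frac z.
have Eab : phi (s * t) * (y * z) = phi (a * b).
  by rewrite !rmorphM -Ea -Eb; ring.
move=> /(mem_pre ie (primeM pP Ps Pt) Eab); rewrite E.
case: (pq) => _ _ qM /qM[qa|qb]; [left|right].
  by apply/(mem_pre ie Ps Ea); rewrite E.
by apply/(mem_pre ie Pt Eb); rewrite E.
Qed.

Lemma pchain_pre n Q0 Q : pchain n Q0 Q -> pchain n (pre Q0) (pre Q).
Proof.
elim: n Q => [|n IHn] Q; first by move=> [-> pQ]; split=> //; apply: pre_prime.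
move=> [Q' [H1 H2 H3]]; exists (pre Q'); split; [exact: IHn| |exact: pre_prime].
by apply/pre_proper => //; apply: prime_ideal => //; exact: pchain_prime H1.
Qed.

Lemma pchain_ext n q0 q : K `<=` q0 -> q `<=` P -> pchain n q0 q ->
  pchain n (ext q0) (ext q).
Proof.
move=> Kq; elim: n q => [|n IHn] q qP.
  by move=> [E pq]; rewrite E in Kq *; split=> //; apply: ext_prime.
move=> [q' [H1 [H2 n2] H3]]; have Kq' : K `<=` q' by move=> x /Kq; apply: (pchain_sub H1).
have q'P : q' `<=` P by move=> x /H2 /qP.
have Kqq : K `<=` q by move=> x /Kq'/H2.
have pq' := pchain_prime H1; exists (ext q'); split; [exact: IHn| |exact: ext_prime].
apply/pre_proper; try by apply: ext_ideal; apply: prime_ideal.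
by rewrite !pre_ext.
Qed.

(** An ideal of L is determined by its contraction, so the images of generators of the contraction
    generate it. *)
Lemma noetherian_transfer : noetherian L.
Proof.
move=> I; have iI := idealr_ideal I.
have [s Es] := noeth_fingen noethA (pre_ideal iI).
pose g (i : 'I_(size s)) := phi (tnth (in_tuple s) i); exists (size s), g.
have mem_g a : a \in s -> exists i, g i = phi a.
  move=> sa; have /tnthP[i ->] : a \in in_tuple s by [].
  by exists i.
have sg x : x \in codom g -> exists2 a, a \in s & x = phi a.
  by move=> /codomP[i ->]; exists (tnth (in_tuple s) i) => //; apply: mem_tnth.
rewrite adjs0_span; have i0 := ideal_set0 L; have iN := adjs_ideal (codom g) i0.
apply/seteqP; split; last first.
  apply: adjs_min => // [_ ->|x /sg[a sa ->]]; first exact: idl0.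
  by have : adjs [set 0] s a; [apply: mem_adjs => //; apply: ideal_set0|rewrite -Es].
apply: pre_mono => //; rewrite Es; apply: adjs_min; first exact: pre_ideal.
  by move=> _ ->; rewrite /pre /= rmorph0; apply: idl0.
move=> a sa; rewrite /pre /=; have [i <-] := mem_g a sa.
by apply: mem_adjs => //; apply: codom_f.
Qed.

Lemma local_ringP (M : idealr L) : local_ring M <-> [set x | x \in M] = ext P.
Proof.
have pE : prime_set (ext P) by apply: ext_prime.
have sub_ext (N : idealr L) : [set x | x \in N] `<=` ext P.
  apply: pre_mono; [exact: idealr_ideal|exact: prime_ideal|].
  rewrite pre_ext //; apply: pre_sub; first exact: idealr_ideal.
  by rewrite /= idealr1.
have [E EE] := ideal_idealr (prime_ideal pE) (let: And3 _ e1 _ := pE in e1).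
have memE (N : idealr L) : [set x | x \in N] = ext P -> forall x, x \in N <-> ext P x.
  by move=> <-.
have maxE (N : idealr L) : [set x | x \in N] = ext P -> maximal_ideal N.
  by move=> /memE EN I _ x xI; apply/EN; apply: sub_ext xI.
have max_eq (N : idealr L) : maximal_ideal N -> [set x | x \in N] = ext P.
  move=> maxN; apply/seteqP; split; first exact: sub_ext.
  rewrite -EE; apply: maxN => x xN; apply/(memE _ EE); exact: sub_ext xN.
split=> [[maxM _]|EM]; first exact: max_eq.
split=> [|N /max_eq EN x]; first exact: maxE.
by apply/idP/idP => [/(memE _ EN)/(memE _ EM)|/(memE _ EM)/(memE _ EN)].
Qed.

Lemma ext_adjs s : ext (adjs K s) = adjs [set 0] (map phi s).
Proof.
have i0 := ideal_set0 L; have iN := adjs_ideal (map phi s) i0.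
have iKs := adjs_ideal s iK; apply/seteqP; split; last first.
  apply: adjs_min; first exact: ext_ideal.
    by move=> _ ->; apply: idl0; apply: ext_ideal.
  move=> _ /mapP[a sa ->]; exists a, 1; split; first by case: pP.
    exact: mem_adjs.
  by rewrite rmorph1 mul1r.
move=> z [a [t [Pt Ha Ea]]]; apply/(mem_pre iN Pt Ea); move: a Ha {Ea}.
apply: adjs_min; first exact: pre_ideal.
- exact: sub_pre.
- by move=> b sb; apply: mem_adjs => //; apply: map_f.
Qed.

Lemma local_gens_transfer s : local_gens P K s -> ext P = adjs [set 0] (map phi s).
Proof.
move=> [sP Ps]; rewrite -ext_adjs; have iKs := adjs_ideal s iK.
apply/seteqP; split=> z [a [t [Pt Ha Ea]]].
  have [u Pu Hu] := Ps a Ha; exists (u * a), (u * t); split=> //; first exact: primeM.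
  by rewrite !rmorphM -mulrA Ea.
exists a, t; split=> //; move: Ha; exact: adjs_min.
Qed.

(** Denominators are units of L, so the generators may be replaced by their numerators. *)
Lemma gens_lift n (g : 'I_n -> L) : ext P = ideal_span (range g) ->
  exists2 s, size s = n & local_gens P K s.
Proof.
rewrite adjs0_span => EP; have i0 := ideal_set0 L.
have gP i : exists at_, [/\ ~ P at_.2, P at_.1 & phi at_.2 * g i = phi at_.1].
  have : ext P (g i) by rewrite EP; apply: mem_adjs => //; apply: codom_f.
  by move=> [a [t H]]; exists (a, t).
have [h Hh] := choice gP; exists [seq (h i).1 | i <- enum 'I_n].
  by rewrite size_map size_enum_ord.
set s := map _ _; have iKs := adjs_ideal s iK; split.
  by move=> _ /mapP[i _ ->]; case: (Hh i).
move=> a Pa; have : ext (adjs K s) (phi a).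
  have : ext P (phi a) by apply/(mem_ext a pP KP).
  rewrite EP; apply: adjs_min; first exact: ext_ideal.
    by move=> _ ->; apply: idl0; apply: ext_ideal.
  move=> _ /codomP[i ->]; have [H1 H2 H3] := Hh i; exists (h i).1, (h i).2.
  by split=> //; apply: mem_adjs => //; apply: map_f; rewrite mem_enum.
move=> [b [t [Pt Hb]]]; rewrite -rmorphM => /phi_eq[u Pu Hu].
exists (u * t); first exact: primeM.
have -> : u * t * a = u * (t * a - b) + u * b by ring.
by apply: idlD => //; [apply: sub_adjs|apply: idlMl].
Qed.

Lemma regular_local_transfer :
  regular_local L <-> exists d, regular_at P K d.
Proof.
have pE : prime_set (ext P) by apply: ext_prime.
have preP (Q : prime_idealr L) : pre [set x | x \in Q] `<=` P.
  by apply: pre_sub; [apply: idealr_ideal|rewrite /= idealr1].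
have chP n (Q : prime_idealr L) : height_ge Q n -> dim_ge P K n.
  move=> /height_geP[Q0 HQ0].
  have [Q1 Q01 HQ1] := pchain_widen pP (@preP Q) (pchain_pre HQ0).
  exists Q1 => // a Ka; apply: Q01; move: a Ka; apply: sub_pre.
  by apply: prime_ideal; apply: pchain_prime0 HQ0.
split=> [[_ [M [d [g [/local_ringP EM [[Q Qd] Qd1] Eg]]]]]|[d [[s sz gens] [Q0 KQ0 HQ0]]]].
  exists d; split; last exact: chP Qd.
  by apply: (@gens_lift _ g); rewrite -EM.
split; first exact: noetherian_transfer.
have [E EE] := prime_set_idealr pE.
exists (E : idealr L), d, (fun i : 'I_d => (map phi s)`_i); split.
- exact/local_ringP.
- split.
    by exists E; apply/height_geP; exists (ext Q0); rewrite EE; apply: pchain_ext.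
  by move=> Q /chP /(dim_le_gens noethA gens); rewrite sz ltnn.
- rewrite EE (local_gens_transfer gens) adjs0_span; congr (adjs _ _).
  have sz' : size (map phi s) = d by rewrite size_map.
  move: (map phi s) sz' => t <-; apply: (@eq_from_nth _ 0); first by rewrite size_codom card_ord.
  move=> i ilt; rewrite codomE (nth_map (Ordinal ilt)) ?size_enum_ord //.
  by rewrite nth_enum_ord.
Qed.

End Transfer.

(** * The local rings of A and of A/J as instances of the transfer *)

Section LocalizationFacts.
Variables (R : comNzRingType) (P : prime_idealr R).
Local Open Scope quotient_scope.

Lemma to_loc_frac (z : localization P) : exists a s, ~ (s \in P) /\ to_loc P s * z = to_loc P a.
Proof.
elim/quotW: z => x; exists x.1, x.2; split; first exact/negP/locden.
by rewrite -[_ * _]/(loc_mul _ _) !piE; apply: loc_ext => /=; ring.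
Qed.

Lemma to_loc_unit s : ~ (s \in P) -> exists t, t * to_loc P s = 1.
Proof.
move=> /negP Ps; exists (\pi_(localization P) (@LocFrac _ P (1, s) Ps)).
transitivity (to_loc P 1); last exact: (rmorph1 (to_loc P)).
by rewrite -[_ * _]/(loc_mul _ _) !piE; apply: loc_ext => /=; ring.
Qed.

Lemma to_loc_eq0 a : to_loc P a = 0 <-> exists2 s, ~ (s \in P) & s * a = 0.
Proof.
have -> : 0 = to_loc P 0 by rewrite (rmorph0 (to_loc P)).
rewrite !piE; split=> [/eqP/loc_eqP[u Pu]|[u Pu ua]].
  by rewrite /= mul0r subr0 mulr1 => ua; exists u => //; apply/negP.
by apply/eqP/loc_eqP; exists u; [exact/negP|rewrite /= mul0r subr0 mulr1].
Qed.

End LocalizationFacts.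

Lemma regular_localization (A : comNzRingType) (P : prime_idealr A) :
  noetherian A -> regular_local (localization P) <->
  exists d, regular_at [set x | x \in P] [set 0] d.
Proof.
move=> noethA; apply: (@regular_local_transfer _ _ (to_loc P)) => //.
- exact: idealr_prime_set.
- exact: ideal_set0.
- by move=> _ ->; apply: rpred0.
- exact: to_loc_frac.
- exact: to_loc_unit.
- exact: to_loc_eq0.
Qed.

Lemma regular_quotient_localization (A : comNzRingType) (J : idealr A)
    (P : prime_idealr A) (sJP : {subset J <= P}) :
  noetherian A -> regular_local (localization (prime_quot sJP)) <->
  exists d, regular_at [set x | x \in P] [set x | x \in J] d.
Proof.
move=> noethA.
pose phi : {rmorphism A -> localization (prime_quot sJP)} :=
  to_loc (prime_quot sJP) \o \pi_{ideal_quot J}%qT.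
apply: (@regular_local_transfer _ _ phi) => //.
- exact: idealr_prime_set.
- exact: idealr_ideal.
- move=> z; have [a [s [Ps E]]] := to_loc_frac z.
  exists (repr a), (repr s); split; first by rewrite /= -(prime_quotE sJP) reprK.
  by rewrite /phi /= !reprK.
- move=> s Ps; have [|t Et] := @to_loc_unit _ (prime_quot sJP) (\pi s)%qT.
    by rewrite prime_quotE.
  by exists t.
- move=> a; rewrite /phi /= to_loc_eq0; split=> -[s Ps].
    rewrite -[s]reprK -rmorphM -(rmorph0 \pi_{ideal_quot J}%qT) => /eqP.
    rewrite -Quotient.idealrBE subr0 => H; exists (repr s) => //=.
    by rewrite -(prime_quotE sJP) reprK.
  move=> Ja; exists (\pi s)%qT; first by rewrite prime_quotE.
  rewrite -rmorphM -[RHS](rmorph0 \pi_{ideal_quot J}%qT); apply/eqP.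
  by rewrite -Quotient.idealrBE subr0.
Qed.

(** The correspondence between primes of A_P and primes inside [P] preserves chains, so the height
    of JA_P is read off from the primes between J and [P]. *)
Lemma ideal_height_localization (A : comNzRingType) (P : prime_idealr A)
    (J : set A) (r : nat) :
  ideal_height (ideal_span (to_loc P @` J)) r ->
  let PA := [set x | x \in P] in
  (forall Q, prime_set Q -> J `<=` Q -> Q `<=` PA -> exists Q0, pchain r Q0 Q) /\
  (exists Q, [/\ prime_set Q, J `<=` Q, Q `<=` PA & forall Q0, ~ pchain r.+1 Q0 Q]).
Proof.
move=> [ht_ge [Q JQ ht_lt]] PA; have pP : prime_set PA by apply: idealr_prime_set.
have i0 := ideal_set0 A.
have zero_sub (I : set A) : ideal_set I -> [set 0] `<=` I.
  by move=> iI _ ->; apply: idl0.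
have frac := @to_loc_frac A P; have unit := @to_loc_unit A P.
have ker : forall a, to_loc P a = 0 <-> sat PA [set 0] a := @to_loc_eq0 A P.
split=> [q pq Jq qP|].
  have q0 := zero_sub _ (prime_ideal pq).
  have pe := ext_prime pP frac unit ker pq q0 qP; have ie := prime_ideal pe.
  have [E EE] := prime_set_idealr pe.
  have [|Q0 H] := (height_geP _ _).1 (ht_ge E _); last first.
    exists (pre (to_loc P) Q0); rewrite EE in H.
    by rewrite -(pre_ext pP ker pq q0 qP); apply: (pchain_pre frac unit).
  move=> x [n [c [g [Hg ->]]]]; rewrite EE; apply: idl_sum => // i; apply: idlMl => //.
  have [j Jj <-] := Hg i; apply/(mem_ext pP ker j pq q0 qP); exact: Jq.
have pQ := idealr_prime_set Q; have [iQ Q1 _] := pQ.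
have qP := pre_sub unit iQ Q1.
exists (pre (to_loc P) [set x | x \in Q]); split=> //; first exact: pre_prime.
  move=> j Jj; apply: JQ; exists 1%N, (fun=> 1), (fun=> to_loc P j).
  by split=> [_|]; [exists j|rewrite big_ord1 mul1r].
move=> Q0 H; apply: ht_lt; apply/height_geP; exists (ext (to_loc P) PA Q0).
have q0 := zero_sub _ (prime_ideal (pchain_prime0 H)).
have := pchain_ext pP frac unit ker q0 qP H.
suff -> : ext (to_loc P) PA (pre (to_loc P) [set x | x \in Q]) = [set x | x \in Q] by [].
have iq := pre_ideal (to_loc P) iQ.
have E : pre (to_loc P) (ext (to_loc P) PA (pre (to_loc P) [set x | x \in Q])) =
    pre (to_loc P) [set x | x \in Q].
  apply: (pre_ext pP ker) => //; first exact: pre_prime.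
  exact: zero_sub.
have ie := ext_ideal pP frac iq.
by apply/seteqP; split; apply: (pre_mono frac unit) => //; rewrite E.
Qed.

(** * Derivations attached to an absolute p-basis *)

Section PBasisDerivation.
Variables (p : nat) (A : comNzRingType) (B : set A).
Hypothesis p_char : p \in [pchar A].
Implicit Types (s t : seq A) (r : seq (A * seq A)).

Let p_gt0 : (0 < p)%N. Proof. by apply: prime_gt0; case/andP: p_char. Qed.

(** Monomials are lists with multiplicity: products become concatenations, and the Leibniz rule for
    the formal derivative [dmono] is an induction on lists. *)
Definition mono s : A := \prod_(x <- s) x.

Fixpoint dmono b s : A :=
  if s is x :: s' then (b == x)%:R * mono s' + x * dmono b s' else 0.

Lemma mono_cons x s : mono (x :: s) = x * mono s.
Proof. by rewrite /mono big_cons. Qed.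

Lemma mono_cat s t : mono (s ++ t) = mono s * mono t.
Proof. by rewrite /mono big_cat. Qed.

Lemma mono_perm s t : perm_eq s t -> mono s = mono t.
Proof. exact: perm_big. Qed.

Lemma dmono_cat b s t : dmono b (s ++ t) = mono s * dmono b t + mono t * dmono b s.
Proof.
elim: s => [|x s IHs] /=; first by rewrite /mono big_nil; ring.
by rewrite IHs mono_cat mono_cons; ring.
Qed.

Lemma dmono_rem b s : dmono b s = (count_mem b s)%:R * mono (rem b s).
Proof.
elim: s => [|x s IHs] /=; first by rewrite mul0r.
rewrite IHs natrD; have [->|xb] := eqVneq b x; last first.
  by rewrite mono_cons /=; ring.
rewrite /=; have [bs|bs] := boolP (x \in s); last first.
  by rewrite (count_memPn bs); ring.
by rewrite (mono_perm (perm_to_rem bs)) mono_cons; ring.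
Qed.

Lemma dmono_perm b s t : perm_eq s t -> dmono b s = dmono b t.
Proof.
move=> st; rewrite !dmono_rem (permP st) [mono _ in RHS](@mono_perm _ (rem b s)) //.
have [bs|bs] := boolP (b \in s); last first.
  by rewrite !rem_id -?(perm_mem st) // perm_sym.
have bt : b \in t by rewrite -(perm_mem st).
rewrite -(perm_cons b) perm_sym -(permPl (perm_to_rem bs)) perm_sym.
by rewrite -(permPl (perm_to_rem bt)) perm_sym.
Qed.

Definition spread (f : A -> nat) s := flatten [seq nseq (f x) x | x <- s].

Lemma count_spread f s c : uniq s ->
  count_mem c (spread f s) = (if c \in s then f c else 0)%N.
Proof.
elim: s => //= x s IHs /andP[xs us]; rewrite /spread /= count_cat IHs //.
rewrite count_nseq /= inE; have [->|xc] := eqVneq c x.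
  by rewrite mul1n (negPf xs) addn0.
by rewrite mul0n.
Qed.

Lemma mono_spread f s : mono (spread f s) = \prod_(x <- s) x ^+ f x.
Proof.
elim: s => [|x s IHs]; first by rewrite /mono /spread /= !big_nil.
rewrite big_cons /spread /= mono_cat -[mono _ in LHS]/(mono (nseq (f x) x)).
rewrite -/(spread f s) IHs; congr (_ * _).
elim: (f x) => [|n IHn]; first by rewrite /mono big_nil.
by rewrite -[nseq _ _]/(x :: nseq n x) mono_cons IHn exprS.
Qed.

(** Exponents are divided by p: [mono_exp] holds the remainders and [mono_root] the quotients, so a
    monomial is a p-th power times a p-monomial. *)
Definition mono_exp s : {fsfun A -> nat with 0%N} :=
  [fsfun x in [fset y in s]%fset => (count_mem x s %% p)%N].

Definition mono_root s := spread (fun x => count_mem x s %/ p)%N (undup s).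

Definition exp_mono (alpha : {fsfun A -> nat with 0%N}) := spread alpha (finsupp alpha).

Lemma mono_expE s x : mono_exp s x = (count_mem x s %% p)%N.
Proof.
rewrite fsfunE !inE; case: ifPn => // xs.
by rewrite (count_memPn _) ?mod0n //; apply: contra xs; rewrite inE.
Qed.

Lemma pmonom_mono alpha : pmonom alpha = mono (exp_mono alpha).
Proof. by rewrite mono_spread. Qed.

Lemma perm_normal s :
  perm_eq s (flatten (nseq p (mono_root s)) ++ exp_mono (mono_exp s)).
Proof.
apply/allP => x _ /=; rewrite count_cat; apply/eqP.
have -> : count_mem x (flatten (nseq p (mono_root s))) =
    (count_mem x s %/ p * p)%N.
  rewrite count_flatten map_nseq sumn_nseq count_spread ?undup_uniq //.
  rewrite mem_undup; case: ifPn => // xs.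
  by rewrite (count_memPn xs) div0n mul0n.
rewrite count_spread ?fset_uniq // mono_expE {1}(divn_eq (count_mem x s) p).
congr (_ + _)%N; case: ifPn => //; rewrite mem_finsupp mono_expE negbK.
by move=> /eqP.
Qed.

Lemma mono_copies n s : mono (flatten (nseq n s)) = mono s ^+ n.
Proof.
elim: n => [|n IHn] /=; first by rewrite /mono big_nil.
by rewrite mono_cat IHn exprS.
Qed.

Lemma dmono_copies b n s :
  dmono b (flatten (nseq n s)) = n%:R * (mono s ^+ n.-1 * dmono b s).
Proof.
elim: n => [|n IHn] /=; first by rewrite mul0r.
rewrite dmono_cat IHn mono_copies -[n.+1]addn1 natrD.
by case: n {IHn} => [|n] /=; rewrite ?expr0 ?exprS; ring.
Qed.

Lemma mono_normal s : mono s = mono (mono_root s) ^+ p * pmonom (mono_exp s).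
Proof. by rewrite (mono_perm (perm_normal s)) mono_cat mono_copies pmonom_mono. Qed.

(** The derivative of the p-th power factor carries the coefficient p = 0. *)
Lemma dmono_normal b s : dmono b s =
  mono (mono_root s) ^+ p * dmono b (exp_mono (mono_exp s)).
Proof.
rewrite (dmono_perm b (perm_normal s)) dmono_cat dmono_copies mono_copies.
by rewrite (pcharf0 p_char) mul0r mulr0 addr0.
Qed.

Lemma pth_powerD (x y : A) : pth_powers p x -> pth_powers p y -> pth_powers p (x + y).
Proof.
move=> [a _ <-] [b _ <-]; exists (a + b) => //.
by have := pFrobenius_autD_comm p_char (mulrC a b); rewrite !pFrobenius_autE.
Qed.

Lemma pth_powerN (x : A) : pth_powers p x -> pth_powers p (- x).
Proof.
move=> [a _ <-]; exists (- a) => //.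
by have := pFrobenius_autN p_char a; rewrite !pFrobenius_autE.
Qed.

Lemma pth_powerM (x y : A) : pth_powers p x -> pth_powers p y -> pth_powers p (x * y).
Proof. by move=> [a _ <-] [b _ <-]; exists (a * b) => //; rewrite exprMn. Qed.

Lemma pth_power0 : pth_powers p (0 : A).
Proof. by exists 0 => //; rewrite expr0n -[p]prednK. Qed.

(* [r] stands for the sum of the [c * mono s], for [(c, s)] in [r]. *)
Definition repr_ok r := forall z, z \in r ->
  pth_powers p z.1 /\ forall x, x \in z.2 -> B x.
Definition rval r := \sum_(z <- r) z.1 * mono z.2.
Definition drval b r := \sum_(z <- r) z.1 * dmono b z.2.

Hypothesis B_basis : absolute_p_basis p B.

Lemma mono_exp_in s : (forall x, x \in s -> B x) -> pmonom_exp p B (mono_exp s).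
Proof.
move=> sB x; rewrite mono_expE; split; first by rewrite ltn_mod.
have [xs _|xs] := boolP (x \in s); first exact: sB.
by rewrite (count_memPn xs) mod0n.
Qed.

(** The formal derivative depends on the element only. Once terms are grouped by reduced p-monomial,
    freeness makes every grouped coefficient vanish, and by [dmono_normal] the same coefficients
    appear in the derivative. *)
Lemma drval0 b r : repr_ok r -> rval r = 0 -> drval b r = 0.
Proof.
move=> ok r0; pose E := [fset mono_exp z.2 | z in r]%fset.
pose c i := \sum_(z <- r | i == mono_exp z.2) z.1 * mono (mono_root z.2) ^+ p.
have regroup (G : {fsfun A -> nat with 0%N} -> A) :
    \sum_(i <- E) c i * G i =
    \sum_(z <- r) z.1 * mono (mono_root z.2) ^+ p * G (mono_exp z.2).
  under eq_bigr do rewrite big_distrl /=.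
  rewrite (exchange_big_dep predT) //= [LHS]big_seq [RHS]big_seq.
  apply: eq_bigr => z zr.
  rewrite (eq_bigr (fun=> z.1 * mono (mono_root z.2) ^+ p * G (mono_exp z.2))); last first.
    by move=> i /eqP ->.
  apply: (@fbig_pred1_inj _ _ _ _ _ (fun=> _) id) => //.
  by apply/imfsetP; exists z.
have cE i : i \in E -> pmonom_exp p B i /\ pth_powers p (c i).
  move=> /imfsetP[z /= zr ->]; split; first by apply: mono_exp_in; case: (ok z zr).
  rewrite /c big_seq_cond; apply: big_ind; [exact: pth_power0|exact: pth_powerD|].
  move=> y /andP[/ok[Hy _] _]; apply: pth_powerM => //.
  by exists (mono (mono_root y.2)).
have c0 : forall i, i \in E -> c i = 0.
  have [_ free] := B_basis; apply: free => //; rewrite regroup -[RHS]r0.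
  by apply: eq_bigr => z _; rewrite -mulrA -mono_normal.
transitivity (\sum_(i <- E) c i * dmono b (exp_mono i)).
  rewrite (regroup (fun i => dmono b (exp_mono i))).
  by apply: eq_bigr => z _; rewrite -mulrA -dmono_normal.
by rewrite big_seq big1 // => i /c0 ->; rewrite mul0r.
Qed.

Lemma ex_repr x : exists2 r, repr_ok r & x = rval r.
Proof.
have [/(_ x)[E [c [cE ->]]] _] := B_basis.
exists [seq (c i, exp_mono i) | i <- E].
  move=> _ /mapP[i /cE[iB ic] ->]; split=> //= y.
  move=> /flattenP[_ /mapP[w /= _ ->]]; rewrite mem_nseq => /andP[wi /eqP ->].
  by case: (iB w) => _; apply; rewrite -lt0n.
by rewrite /rval big_map; apply: eq_bigr => i _; rewrite pmonom_mono.
Qed.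

Definition dB b x : A := xget 0 [set y | exists2 r, repr_ok r & x = rval r /\ y = drval b r].

Lemma dB_rval b r : repr_ok r -> dB b (rval r) = drval b r.
Proof.
move=> ok; rewrite /dB; case: xgetP => [y _ /= [t okt [E ->]]|/(_ (drval b r))]; last first.
  by case; exists r.
(* Two representations of one element differ by a representation of 0. *)
apply/eqP; rewrite -subr_eq0; pose u := t ++ [seq (- z.1, z.2) | z <- r].
have -> : drval b t - drval b r = drval b u.
  rewrite /drval big_cat big_map /= -sumrN; congr (_ + _).
  by apply: eq_bigr => z _; rewrite mulNr.
apply/eqP; apply: drval0.
  move=> z; rewrite mem_cat => /orP[/okt//|/mapP[y' /ok[H1 H2] ->]].
  by split=> //; apply: pth_powerN.
rewrite /rval big_cat big_map /= -[\sum_(i <- t) _]/(rval t) -E.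
by rewrite -[rval r]opprK -sumrN addrC; apply/eqP; rewrite subr_eq0; apply/eqP/eq_bigr => z _; rewrite mulNr.
Qed.

Lemma dB_derivation b : derivation (dB b).
Proof.
split=> x y; have [r okr ->] := ex_repr x; have [t okt ->] := ex_repr y.
  have -> : rval r + rval t = rval (r ++ t) by rewrite /rval big_cat.
  rewrite !dB_rval //; first by rewrite /drval big_cat.
  by move=> z; rewrite mem_cat => /orP[/okr|/okt].
pose u := [seq (z.1 * w.1, z.2 ++ w.2) | z <- r, w <- t].
have -> : rval r * rval t = rval u.
  rewrite /rval big_allpairs_dep big_distrl; apply: eq_bigr => z _ /=.
  by rewrite big_distrr; apply: eq_bigr => w _ /=; rewrite mono_cat; ring.
rewrite !dB_rval //; last first.
  move=> _ /allpairsP[[z w] /= [/okr[z1 z2] /okt[w1 w2] ->]].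
  split=> /= [|c]; first exact: pth_powerM.
  by rewrite mem_cat => /orP[/z2|/w2].
rewrite /drval /rval big_allpairs_dep [X in _ = X + _]big_distrl.
rewrite [X in _ = _ + X]big_distrl [X in _ = _ + X](eq_bigr (fun w => \sum_(z <- r)
   w.1 * mono w.2 * (z.1 * dmono b z.2))); last by move=> w _; rewrite big_distrr.
rewrite [X in _ = _ + X]exchange_big -big_split; apply: eq_bigr => z _ /=.
rewrite big_distrr -big_split; apply: eq_bigr => w _ /=.
by rewrite dmono_cat; ring.
Qed.

Lemma dB_basis b c : B c -> dB b c = (b == c)%:R.
Proof.
move=> Bc; have ok : repr_ok [:: (1, [:: c])].
  move=> z; rewrite inE => /eqP ->; split=> /= [|x]; first by exists 1 => //; rewrite expr1n.
  by rewrite inE => /eqP ->.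
have E : c = rval [:: (1, [:: c])] by rewrite /rval /mono !big_seq1 mul1r.
by rewrite {1}E dB_rval // /drval big_seq1 /= /mono big_nil; ring.
Qed.

(** [dB] is an admissible derivation, so the choice defining [pderiv] never falls back on its
    default. *)
Lemma pderiv_basis b : derivation (pderiv B b) /\
  forall c, B c -> pderiv B b c = (b == c)%:R.
Proof.
rewrite /pderiv; case: xgetP => [D _ //|/(_ (dB b))]; case.
by split; [exact: dB_derivation|exact: dB_basis].
Qed.

(** Says that [f] lies in the subring generated by the p-th powers and finitely many elements of
    [B], in the form of an induction principle. *)
Lemma p_basis_ind (f : A) : exists2 S : seq A, (forall b, b \in S -> B b) &
  forall H : A -> Prop, (forall a, H (a ^+ p)) -> (forall b, b \in S -> H b) ->
  (forall x y, H x -> H y -> H (x + y)) -> (forall x y, H x -> H y -> H (x * y)) -> H f.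
Proof.
have [r ok ->] := ex_repr f; exists (flatten [seq z.2 | z <- r]).
  by move=> b /flattenP[_ /mapP[z /ok[_ H] ->] /H].
move=> H Hp HS HD HM; rewrite /rval big_seq; apply: big_ind => //.
  by have [a _ <-] := pth_power0; apply: Hp.
move=> z zr; apply: (HM); first by have [[a _ <-] _] := ok z zr; apply: Hp.
have : forall x, x \in z.2 -> H x.
  by move=> x xz; apply: HS; apply/flattenP; exists z.2 => //; apply: map_f.
elim: z.2 => [_|x s IHs Hs]; first by rewrite /mono big_nil -(expr1n _ p).
rewrite mono_cons; apply: (HM); first by apply: Hs; rewrite mem_head.
by apply: IHs => y ys; apply: Hs; rewrite inE ys orbT.
Qed.

End PBasisDerivation.

(** * Coefficient rings modulo the square of the maximal ideal *)

Section PureInseparable.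
Variables (p : nat) (K : fieldType) (k : set K) (beta : K).
Hypothesis p_char : p \in [pchar K].
Hypotheses (k1 : k 1) (kB : forall x y, k x -> k y -> k (x - y))
  (kM : forall x y, k x -> k y -> k (x * y)) (kV : forall x, k x -> k x^-1).

Let k0 : k 0. Proof. by rewrite -(subrr 1); apply: kB. Qed.

Let knat n : k n%:R.
Proof.
elim: n => [|n kn]; first exact: k0.
have -> : n.+1%:R = n%:R - (0 - 1) :> K by rewrite sub0r opprK natr1.
by apply: (kB kn); apply: (kB k0 k1).
Qed.

(** Euclidean division is redone by hand because [k] is a mere subset of K, and the remainder must
    keep its coefficients in it. *)
Lemma poly_over_rem (g f : {poly K}) : g != 0 -> (forall i, k g`_i) ->
  (forall i, k f`_i) -> exists r : {poly K},
  [/\ forall i, k r`_i, (size r < size g)%N & g %| f - r].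
Proof.
move=> g0 kg; have [n] := ubnP (size f); elim: n f => // n IHn f.
rewrite ltnS => sf kf; have [fg|gf] := ltnP (size f) (size g).
  by exists f; rewrite subrr dvdp0.
pose c := lead_coef f / lead_coef g; pose d := (size f - size g)%N.
have sg : (0 < size g)%N by rewrite size_poly_gt0.
have cg : c * lead_coef g = lead_coef f by rewrite divfK // lead_coef_eq0.
have [|i|r [kr sr gr]] := IHn (f - c *: ('X^d * g)).
- have sf0 : (0 < size f)%N by apply: leq_trans gf.
  suff : (size (f - c *: ('X^d * g))%R <= (size f).-1)%N by lia.
  apply/leq_sizeP => j; rewrite coefB coefZ coefXnM leq_eqVlt => /orP[/eqP <-|sfj].
    rewrite ifN; last by rewrite /d; lia.
    have -> : ((size f).-1 - d = (size g).-1)%N by rewrite /d; lia.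
    by rewrite -[g`__]/(lead_coef g) cg subrr.
  rewrite [f`_j]nth_default; last by rewrite -(prednK sf0).
  have dj : (size g <= j - d)%N by rewrite leq_subRL /d; [rewrite addnC subnKC // -(prednK sf0)|apply: leq_trans sfj; rewrite leq_subLR; lia].
  rewrite ifN; last by rewrite -leqNgt; apply: leq_trans (leq_subr _ _) _; rewrite -(prednK sf0).
  by rewrite [g`__]nth_default ?mulr0 ?subrr.
- rewrite coefB coefZ coefXnM; apply: kB => //; apply: kM.
    by apply: kM; [exact: kf|apply: kV; exact: kg].
  by case: ifP.
- exists r; split=> //.
  have -> : f - r = (f - c *: ('X^d * g) - r) + c *: ('X^d * g) by rewrite addrAC subrK.
  by rewrite dvdp_add // scalerAl dvdp_mull.
Qed.

Lemma coef_exp_XsubC m : (('X - beta%:P) ^+ m.+1)`_m = - (m.+1%:R * beta).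
Proof.
elim: m => [|m IHm]; first by rewrite expr1 coefB coefX coefC /= mul1r sub0r.
rewrite exprS mulrBl coefB coefXM coefCM /= IHm.
have := lead_coef_exp ('X - beta%:P) m.+1; rewrite lead_coefXsubC expr1n.
by rewrite /lead_coef size_exp_XsubC /= => ->; rewrite -[m.+2%:R]natr1; ring.
Qed.

(* [X^p - beta^p = (X - beta)^p] is irreducible over [k]: a divisor over [k]  *)
(* is, up to a scalar, some (X - beta)^n, whose coefficient of degree n - 1   *)
(* is [- n beta]. *)
Lemma inseparable_free (g : {poly K}) : k (beta ^+ p) -> ~ k beta ->
  (forall i, k g`_i) -> (size g <= p)%N -> root g beta -> g = 0.
Proof.
move=> kbp nkb; have [n] := ubnP (size g); elim: n g => // n IHn g.
rewrite ltnS => sn kg sp /eqP gb; apply/eqP; apply: contrapT => /negP g0.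
pose f : {poly K} := ('X - beta%:P) ^+ p.
have fE : f = 'X^p - (beta ^+ p)%:P.
  have pc : p \in [pchar {poly K}] by rewrite pchar_poly.
  have := GRing.pFrobenius_autB_comm pc (mulrC 'X beta%:P).
  by rewrite !GRing.pFrobenius_autE -rmorphXn.
have kf i : k f`_i.
  rewrite fE coefB coefXn coefC; apply: kB; first by case: eqP => _; [exact: k1|exact: k0].
  by case: eqP => _; [exact: kbp|exact: k0].
have [r [kr sr gr]] := poly_over_rem g0 kg kf.
(* The remainder vanishes at [beta] and is smaller than [g], so the induction applies; hence [g]
   divides (X - beta)^p. *)
have r0 : r = 0.
  apply: IHn => //; [exact: leq_trans sr _|exact: leq_trans (ltnW sr) sp|].
  have /dvdpP[h E] := gr; have : (f - r).[beta] = 0 by rewrite E hornerM gb mulr0.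
  rewrite hornerD hornerN /f horner_exp hornerXsubC subrr expr0n.
  by rewrite gtn_eqF ?prime_gt0 ?(pcharf_prime p_char) // sub0r => /eqP; rewrite oppr_eq0.
rewrite r0 subr0 in gr; have /dvdp_exp_XsubCP[m mp gE] := gr.
have [c c0 E] : exists2 c, c != 0 & g = c *: ('X - beta%:P) ^+ m.
  by move/eqpP: gE => [[c1 c2] /= /andP[c10 c20] E]; exists (c1^-1 * c2);
     [rewrite mulf_neq0 ?invr_eq0|rewrite -scalerA -E scalerA mulVf ?scale1r].
have sg : size g = m.+1 by rewrite E size_scale // size_exp_XsubC.
have lg : g`_m = c.
  have := lead_coef_exp ('X - beta%:P) m; rewrite lead_coefXsubC expr1n.
  by rewrite /lead_coef size_exp_XsubC /= E coefZ => ->; rewrite mulr1.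
case: m {mp gE} sg lg E => [|m] sg lg E.
  by move: gb; rewrite E expr0 hornerZ hornerC mulr1 => /eqP; rewrite (negPf c0).
have gm : g`_m = - (c * (m.+1%:R * beta)) by rewrite E coefZ coef_exp_XsubC mulrN.
(* The bound on the size of [g] gives m + 1 < p. *)
have m0 : m.+1%:R != 0 :> K.
  rewrite -(dvdn_pcharf p_char) gtnNdvd //; lia.
apply: nkb; have -> : beta = (0 - g`_m) / g`_m.+1 / m.+1%:R.
  by rewrite lg gm sub0r opprK [c * _]mulrC mulfK // mulrAC mulfV // mul1r.
apply: kM; last by apply: kV; apply: knat.
by apply: kM; [apply: kB|apply: kV].
Qed.

End PureInseparable.

Section CoefficientRing.
Variables (p : nat) (L : comNzRingType) (K : fieldType) (rho : {rmorphism L -> K}).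
Variable Q : set L.
Hypothesis p_char : p \in [pchar L].
Hypothesis iQ : ideal_set Q.
Hypothesis Q_ker : forall a, Q a -> rho a = 0.
Hypothesis ker_pow : forall a, rho a = 0 -> Q (a ^+ p).
Hypothesis rho_unit : forall a, rho a != 0 -> exists t, t * a = 1.
Implicit Types F : set L.

(* Modulo [Q], such an [F] is a field that contains all [p]-th powers. *)
Definition coef_ring F :=
  [/\ Q `<=` F, forall a, F (a ^+ p), forall a b, F a -> F b -> F (a + b),
      forall a b, F a -> F b -> F (a * b) & forall a, F a -> rho a = 0 -> Q a].

Let p_gt0 : (0 < p)%N. Proof. by apply: prime_gt0; case/andP: p_char. Qed.

Lemma coef_ring1 F : coef_ring F -> F 1.
Proof. by case=> _ + _ _ _ => /(_ 1); rewrite expr1n. Qed.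

Lemma coef_ringN F a : coef_ring F -> F a -> F (- a).
Proof.
move=> cF Fa; rewrite -mulN1r; have [_ Fp _ FM _] := cF; apply: (FM) => //.
by have := Fp (-1); rewrite -GRing.pFrobenius_autE GRing.pFrobenius_autN
  GRing.pFrobenius_aut1.
Qed.

(** The inverse of a is the p-th power of itself times a^(p-1), hence in [F]. *)
Lemma coef_ringV F a : coef_ring F -> F a -> exists2 t, F t & rho t = (rho a)^-1.
Proof.
move=> cF Fa; have [QF Fp FD FM _] := cF; have [a0|a0] := eqVneq (rho a) 0.
  by exists 0; [apply: QF; apply: idl0|rewrite a0 invr0 rmorph0].
have [t ta] := rho_unit a0; exists (t ^+ p * a ^+ p.-1).
  apply: (FM) => //; elim: p.-1 => [|n IHn]; first by rewrite expr0; apply: coef_ring1.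
  by rewrite exprS; apply: (FM).
have E : t ^+ p * a ^+ p.-1 = t.
  by rewrite -[in t ^+ p](prednK p_gt0) exprS -mulrA -exprMn ta expr1n mulr1.
by rewrite E; apply: (mulIf a0); rewrite mulVf // -rmorphM ta rmorph1.
Qed.

(** If the residue of [b] is not yet represented, F[b] works. Elements of F[b] are polynomials in
    [b] of degree < p, as b^p is in [F]; if such a value has residue 0, [inseparable_free] kills the
    residues of all coefficients, which therefore lie in [Q]. *)
Lemma coef_ring_extend F b : coef_ring F ->
  exists2 F', coef_ring F' & F `<=` F' /\ exists2 u, F' u & rho (b - u) = 0.
Proof.
move=> cF; have [QF Fp FD FM Fker] := cF.
have F0 : F 0 by apply: QF; apply: idl0.
have [[u Fu Eu]|nb] := pselect (exists2 u, F u & rho u = rho b).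
  by exists F => //; split=> //; exists u => //; rewrite rmorphB Eu subrr.
pose F' : set L := [set x | exists2 g : {poly L}, forall i, F g`_i & x = g.[b]].
have FF' : F `<=` F'.
  move=> a Fa; exists a%:P; last by rewrite hornerC.
  by move=> i; rewrite coefC; case: eqP.
exists F'; last first.
  split=> //; exists b; last by rewrite subrr rmorph0.
  exists 'X; last by rewrite hornerX.
  by move=> i; rewrite coefX; case: eqP => _ //; apply: coef_ring1.
split.
- by move=> a /QF /FF'.
- by move=> a; apply: FF'.
- move=> _ _ [g Fg ->] [h Fh ->]; exists (g + h); last by rewrite hornerD.
  by move=> i; rewrite coefD; apply: (FD).
- move=> _ _ [g Fg ->] [h Fh ->]; exists (g * h); last by rewrite hornerM.
  by move=> i; rewrite coefM; apply: big_ind => // j _; apply: (FM).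
move=> _ [g Fg ->]; have [n] := ubnP (size g).
elim: n g Fg => // n IHn g Fg; rewrite ltnS => sg gb0.
have [sp|ps] := leqP (size g) p; last first.
  (* The leading term is lowered by replacing X^p with b^p, which does not change the value at
     [b]. *)
  pose h := g - (g`_(size g).-1)%:P * ('X^((size g).-1 - p) * ('X^p - (b ^+ p)%:P)).
  have hb : h.[b] = g.[b].
    by rewrite /h !(hornerD, hornerN, hornerM, hornerXn, hornerC) subrr !mulr0 subr0.
  have hE i : h`_i = g`_i - g`_(size g).-1 *
      (if (i < (size g).-1 - p)%N then 0
       else (i - ((size g).-1 - p) == p)%N%:R - (if (i - ((size g).-1 - p) == 0)%N then b ^+ p else 0)).
    by rewrite coefB coefCM coefXnM coefB coefXn coefC.
  rewrite -hb; apply: IHn; last by rewrite hb.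
    move=> i; rewrite hE; apply: (FD) => //; apply: coef_ringN => //; apply: (FM) => //.
    case: ifP => // _; apply: (FD).
      by case: eqP => _; [exact: coef_ring1|exact: F0].
    by apply: coef_ringN => //; case: ifP.
  suff : (size h <= (size g).-1)%N by move: ps sg; case: (size g) => //= *; lia.
  apply/leq_sizeP => i; rewrite leq_eqVlt => /orP[/eqP <-|gi].
    rewrite hE ifN; last by rewrite -leqNgt leq_subr.
    have lep : (p <= (size g).-1)%N by move: ps; case: (size g).
    by rewrite subKn // eqxx gtn_eqF // subr0 mulr1 subrr.
  rewrite hE ifN; last by rewrite -leqNgt (leq_trans (leq_subr _ _)) // ltnW.
  have lep : (p <= (size g).-1)%N by move: ps; case: (size g).
  have pi : (p < i - ((size g).-1 - p))%N by rewrite ltn_subRL subnK.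
  rewrite nth_default; last by move: gi; case: (size g).
  by rewrite !gtn_eqF // ?(leq_ltn_trans _ pi) // subr0 mulr0 subrr.
pose k : set K := rho @` F.
have k1 : k 1 by exists 1; [exact: coef_ring1|rewrite rmorph1].
have kB x y : k x -> k y -> k (x - y).
  move=> [a Fa <-] [c Fc <-]; exists (a - c); last by rewrite rmorphB.
  by apply: (FD) => //; apply: coef_ringN.
have kM x y : k x -> k y -> k (x * y).
  by move=> [a Fa <-] [c Fc <-]; exists (a * c); [exact: FM|rewrite rmorphM].
have kV x : k x -> k x^-1.
  by move=> [a Fa <-]; have [t Ft Et] := coef_ringV cF Fa; exists t.
have pK : p \in [pchar K] by apply: rmorph_pchar p_char.
have g0 : map_poly rho g = 0.
  apply: (inseparable_free pK k1 kB kM kV (beta := rho b)).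
  - by exists (b ^+ p) => //; rewrite rmorphXn.
  - by move=> [u Fu Eu]; apply: nb; exists u.
  - by move=> i; rewrite coef_map; exists g`_i.
  - exact: leq_trans (size_poly _ _) sp.
  - by rewrite /root horner_map gb0.
rewrite horner_coef; apply: idl_sum => // i; apply: idlMr => //.
by apply: Fker => //; rewrite -coef_map g0 coef0.
Qed.

(** The construction starts from the p-th powers plus [Q]; by [ker_pow] this ring meets the kernel
    of [rho] inside [Q]. *)
Lemma coef_ring_exists (S : seq L) :
  exists2 F, coef_ring F & forall b, b \in S -> exists2 u, F u & rho (b - u) = 0.
Proof.
elim: S => [|b S [F cF HF]].
  exists [set x | exists a q, Q q /\ x = a ^+ p + q] => //; split.
  - by move=> q Qq; exists 0, q; split=> //; rewrite expr0n gtn_eqF // add0r.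
  - by move=> a; exists a, 0; rewrite addr0; split=> //; apply: idl0.
  - move=> _ _ [a [q [Qq ->]]] [b [r [Qr ->]]]; exists (a + b), (q + r).
    split; first exact: idlD.
    have := GRing.pFrobenius_autD_comm p_char (mulrC a b).
    by rewrite !GRing.pFrobenius_autE => ->; ring.
  - move=> _ _ [a [q [Qq ->]]] [b [r [Qr ->]]].
    exists (a * b), (a ^+ p * r + (b ^+ p + r) * q); split.
      by apply: idlD => //; apply: idlMl.
    by rewrite exprMn; ring.
  - move=> _ [a [q [Qq ->]]]; rewrite rmorphD (Q_ker Qq) addr0 rmorphXn.
    move=> /eqP; rewrite expf_eq0 p_gt0 /= => /eqP /ker_pow Qa.
    exact: idlD.
have [F' cF' [FF' Hb]] := coef_ring_extend b cF.
exists F' => // c; rewrite inE => /orP[/eqP -> //|/HF[u Fu Eu]].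
by exists u => //; apply: FF'.
Qed.

End CoefficientRing.

Lemma fracB (F : fieldType) (a b c d : F) : b != 0 -> d != 0 ->
  (a * d + - c * b) / (b * d) = a / b - c / d.
Proof. by move=> b0 d0; field; rewrite b0 d0. Qed.

Lemma fracM (F : fieldType) (a b c d : F) : (a * c) / (b * d) = (a / b) * (c / d).
Proof. by rewrite invfM mulrACA. Qed.

Lemma frac_eq (F : fieldType) (u a b c d : F) : u != 0 -> b != 0 -> d != 0 ->
  u * (a * d - c * b) = 0 -> c / d = a / b.
Proof.
move=> u0 b0 d0 /eqP; rewrite mulf_eq0 (negPf u0) subr_eq0 => /eqP E.
by apply/eqP; rewrite eqr_div // E.
Qed.

Lemma fraction_tofrac (R : idomainType) (z : {fraction R}) :
  exists x y, y != 0 /\ z = FracField.tofrac x / FracField.tofrac y.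
Proof.
elim/quotW: z => z; exists \n_z, \d_z; split; first exact: denom_ratioP.
apply: (canRL (mulfK _)); first by rewrite tofrac_eq0 denom_ratioP.
rewrite -[_ * _]/(FracField.mul _ _) !piE; apply/eqmodP.
rewrite /= FracField.equivfE /FracField.mulf.
by rewrite !numden_Ratio ?(oner_eq0, mulf_neq0, denom_ratioP) // !mulr1 mulrC.
Qed.

(** * The residue field of A_P and the reduction map *)

Section ResidueMap.
Variables (A : comNzRingType) (P : prime_idealr A).
Local Open Scope quotient_scope.

Lemma to_residueB : zmod_morphism (to_residue P).
Proof.
by move=> a b; rewrite /to_residue; rewrite [\pi_(dom_quot P) _](rmorphB (\pi_{ideal_quot P})) tofracB.
Qed.

Lemma to_residueM : monoid_morphism (to_residue P).
Proof.
split=> [|a b]; rewrite /to_residue.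
  by rewrite [\pi_(dom_quot P) _](rmorph1 (\pi_{ideal_quot P})) tofrac1.
by rewrite [\pi_(dom_quot P) _](rmorphM (\pi_{ideal_quot P})) tofracM.
Qed.

HB.instance Definition _ :=
  GRing.isZmodMorphism.Build A (residue_field P) (to_residue P) to_residueB.
HB.instance Definition _ :=
  GRing.isMonoidMorphism.Build A (residue_field P) (to_residue P) to_residueM.

Lemma to_residue_eq0 a : (to_residue P a == 0) = (a \in P).
Proof.
rewrite /to_residue tofrac_eq0 -[a in RHS]subr0 Quotient.idealrBE.
by rewrite [\pi 0](rmorph0 (\pi_{ideal_quot P})).
Qed.

Lemma residue_frac (z : residue_field P) :
  exists a s, ~ (s \in P) /\ z = to_residue P a / to_residue P s.
Proof.
have [x [y [y0 ->]]] := fraction_tofrac z.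
have E (w : dom_quot P) : FracField.tofrac w = to_residue P (repr w).
  by rewrite /to_residue [\pi_(dom_quot P) _]reprK.
exists (repr x), (repr y); split; last by rewrite !E.
by apply/negP; rewrite -to_residue_eq0 -E tofrac_eq0.
Qed.

Definition loc_residue (z : localization P) : residue_field P :=
  to_residue P (repr z).1 / to_residue P (repr z).2.

Lemma loc_residueE (x : locfrac P) :
  loc_residue (\pi x) = to_residue P x.1 / to_residue P x.2.
Proof.
have nz (y : locfrac P) : to_residue P y.2 != 0 by rewrite to_residue_eq0 locden.
have [u Pu Eu] := loc_repr x; rewrite /loc_residue.
apply: (@frac_eq _ (to_residue P u)) => //; first by rewrite to_residue_eq0.
by rewrite -!rmorphM -rmorphB -rmorphM Eu rmorph0.
Qed.

Let pi_loc : locfrac P -> localization P := \pi_(localization P).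

Let pi_locB x y : pi_loc (addlf x (opplf y)) = pi_loc x - pi_loc y.
Proof. by rewrite -[_ - _]/(loc_add _ (loc_opp _)) /pi_loc !piE. Qed.

Let pi_locM x y : pi_loc (mullf x y) = pi_loc x * pi_loc y.
Proof. by rewrite -[_ * _]/(loc_mul _ _) /pi_loc !piE. Qed.

Let pi_loc_in a : to_loc P a = pi_loc (inlf P a).
Proof. by rewrite /pi_loc !piE. Qed.

Lemma loc_residueB : zmod_morphism loc_residue.
Proof.
have nz (y : locfrac P) : to_residue P y.2 != 0 by rewrite to_residue_eq0 locden.
elim/quotW=> x; elim/quotW=> y.
rewrite -[_ - _]/(pi_loc x - pi_loc y) -pi_locB.
rewrite !loc_residueE /= !(rmorphD, rmorphM, rmorphN); apply: fracB; apply: nz.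
Qed.

Lemma loc_residueM : monoid_morphism loc_residue.
Proof.
split.
  transitivity (loc_residue (to_loc P 1)).
    by congr loc_residue; rewrite (rmorph1 (to_loc P)).
  by rewrite pi_loc_in /pi_loc loc_residueE /= rmorph1 divr1.
elim/quotW=> x; elim/quotW=> y.
rewrite -[_ * _]/(pi_loc x * pi_loc y) -pi_locM.
by rewrite !loc_residueE /= !rmorphM; apply: fracM.
Qed.

HB.instance Definition _ :=
  GRing.isZmodMorphism.Build _ _ loc_residue loc_residueB.
HB.instance Definition _ :=
  GRing.isMonoidMorphism.Build _ _ loc_residue loc_residueM.

Lemma loc_residue_to_loc a : loc_residue (to_loc P a) = to_residue P a.
Proof. by rewrite pi_loc_in /pi_loc loc_residueE /= rmorph1 divr1. Qed.

End ResidueMap.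

Lemma derivationX (A : comNzRingType) (D : A -> A) (x : A) n :
  derivation D -> D (x ^+ n) = n%:R * (x ^+ n.-1 * D x).
Proof.
move=> [DD DM]; elim: n => [|n IHn].
  rewrite expr0 mul0r; have := DM 1 1; rewrite !mul1r => /eqP.
  by rewrite -subr_eq0 opprD addrA subrr sub0r oppr_eq0 => /eqP.
rewrite exprS DM IHn -[n.+1%:R]natr1 /=.
by case: n {IHn} => [|n] /=; rewrite ?expr0 ?exprS; ring.
Qed.

Lemma derivation_pth (p : nat) (A : comNzRingType) (D : A -> A) (x : A) :
  p \in [pchar A] -> derivation D -> D (x ^+ p) = 0.
Proof. by move=> pc dD; rewrite derivationX // (pcharf0 pc) mul0r. Qed.

Lemma derivation0 (A : comNzRingType) (D : A -> A) : derivation D -> D 0 = 0.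
Proof.
by move=> [DD _]; have := DD 0 0; rewrite addr0 => /eqP; rewrite -subr_eq0 opprD addrA subrr sub0r oppr_eq0 => /eqP.
Qed.

Lemma derivation_sum (A : comNzRingType) (D : A -> A) (I : Type) (r : seq I)
  (F : I -> A) : derivation D -> D (\sum_(i <- r) F i) = \sum_(i <- r) D (F i).
Proof.
by move=> dD; apply: (big_morph D _ (derivation0 dD)); case: dD.
Qed.

(* Let [y_b] be the part in the maximal ideal of [b], relative to a           *)
(* coefficient ring modulo the square of the maximal ideal. First-order Taylor *)
(* expansion: [x - sum_b (dx/db) y_b] lies in the coefficient ring. *)
Lemma pderiv_kernel (p : nat) (A : comNzRingType) (B : set A) (P : prime_idealr A)
    (f : A) : p \in [pchar A] -> absolute_p_basis p B -> f \in P ->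
  (forall b, B b -> pderiv B b f \in P) ->
  sat [set x | x \in P] (addsq [set x | x \in P] [set 0]) f.
Proof.
move=> p_char B_basis fP dfP; set PA := [set x | x \in P].
have pP : prime_set PA by apply: idealr_prime_set.
pose L := localization P; pose phi : {rmorphism A -> L} := to_loc P.
have [rho rho_phi] : exists rho : {rmorphism L -> residue_field P},
    forall a, rho (phi a) = to_residue P a.
  by exists (@loc_residue A P) => a; apply: loc_residue_to_loc.
pose m : set L := [set z | rho z = 0].
have im : ideal_set m.
  split=> [|a b|a b]; rewrite /m /=; first by rewrite rmorph0.
    by rewrite rmorphD => -> ->; rewrite addr0.
  by rewrite rmorphM => ->; rewrite mulr0.
pose Q := mulI m m; have iQ : ideal_set Q by apply: mulI_ideal.
have p1 : (1 < p)%N by apply: prime_gt1; case/andP: p_char.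
have mP a z s : ~ PA s -> phi s * z = phi a -> m z -> PA a.
  move=> Ps E mz; rewrite /PA /= -to_residue_eq0 -rho_phi -E rmorphM mz mulr0.
  by [].
have rho_unit z : rho z != 0 -> exists t, t * z = 1.
  have [a [s [Ps E]]] := to_loc_frac z => nz.
  have [|t Et] := @to_loc_unit _ P a.
    move=> aP; have /eqP := congr1 rho E; rewrite rmorphM !rho_phi.
    have /eqP -> : to_residue P a == 0 by rewrite to_residue_eq0.
    by rewrite mulf_eq0 (negPf nz) orbF to_residue_eq0 => /Ps.
  by exists (t * phi s); rewrite -mulrA E.
have L_char : p \in [pchar L] by apply: rmorph_pchar p_char.
have Q_ker a : Q a -> rho a = 0.
  by move=> Qa; apply: (mulI_min im _ Qa) => x y mx _; apply: (idlMr _ im mx).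
have ker_pow a : rho a = 0 -> Q (a ^+ p).
  move=> a0; rewrite -(subnKC p1) exprD expr2; apply: idlMr => //.
  exact: mem_mulI.
have [S SB HS] := p_basis_ind p_char B_basis f.
have [F cF HF] := coef_ring_exists L_char iQ Q_ker ker_pow rho_unit (map phi S).
have [QF Fp FD FM Fker] := cF.
have [u Hu] : exists u : A -> L, forall b, b \in S -> F (u b) /\ rho (phi b - u b) = 0.
  suff /choice[u Hu] : forall b, exists u, b \in S -> F u /\ rho (phi b - u) = 0 by exists u.
  move=> b; have [bS|_] := boolP (b \in S); last by exists 0.
  by have [|v Fv Ev] := HF (phi b); [exact: map_f|exists v].
pose y b := phi b - u b; pose S' := undup S.
pose s x := \sum_(b <- S') phi (pderiv B b x) * y b.
have my b : b \in S' -> m (y b) by rewrite mem_undup => /Hu[].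
have ms x : m (s x).
  rewrite /s big_seq; apply: big_ind; [exact: idl0|by move=> *; apply: idlD|].
  by move=> b /my; apply: idlMl.
(* The Taylor property is propagated from p-th powers and basis elements to [f] by [p_basis_ind]. *)
pose H x := exists2 v, F v & Q (phi x - s x - v).
have dB b := pderiv_basis p_char B_basis b.
have [v Fv Qv] : H f.
  apply: HS.
  - move=> a; exists (phi (a ^+ p)); first by rewrite rmorphXn.
    rewrite /s big1 ?subr0 ?subrr; first exact: idl0.
    by move=> b _; have [dD _] := dB b; rewrite (derivation_pth a p_char dD) rmorph0 mul0r.
  - move=> b bS; have [Fu _] := Hu b bS; exists (u b) => //.
    have -> : s b = y b.
      rewrite /s (bigD1_seq b) ?mem_undup ?undup_uniq //= big1 => [|c cb].
        by have [_ ->] := dB b; rewrite ?eqxx ?rmorph1 ?mul1r ?addr0 //; apply: SB.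
      have [_ ->] := dB c; last exact: SB.
      by rewrite (negPf cb) rmorph0 mul0r.
    rewrite /y; have -> : phi b - (phi b - u b) - u b = 0 by ring.
    exact: idl0.
  - move=> x x' [v Fv Qv] [v' Fv' Qv']; exists (v + v'); first exact: FD.
    have -> : s (x + x') = s x + s x'.
      rewrite /s -big_split; apply: eq_bigr => b _ /=.
      by have [[-> _] _] := dB b; rewrite rmorphD mulrDl.
    have -> : phi (x + x') - (s x + s x') - (v + v') =
      (phi x - s x - v) + (phi x' - s x' - v') by rewrite rmorphD; ring.
    exact: idlD.
  - move=> x x' [v Fv Qv] [v' Fv' Qv']; exists (v * v'); first exact: FM.
    have -> : s (x * x') = phi x * s x' + phi x' * s x.
      rewrite /s !big_distrr -big_split; apply: eq_bigr => b _ /=.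
      by have [[_ ->] _] := dB b; rewrite rmorphD !rmorphM; ring.
    move: (ms x) (ms x') Qv Qv'; rewrite rmorphM.
    move: (phi x) (phi x') (s x) (s x') => X X' t t' mt mt' Qe Qe'.
    (* The error in the product rule is t t', a product of two elements of the maximal ideal. *)
    have -> : X * X' - (X * t' + X' * t) - v * v' =
      (v + (X - t - v)) * (X' - t' - v') + v' * (X - t - v) - t * t' by ring.
    apply: idlB => //; last exact: mem_mulI.
    by apply: idlD => //; apply: idlMl.
(* The derivatives of [f] are in the maximal ideal, so [s f] is in its square; then [v] is in [F]
   with residue 0, hence in [Q]. *)
have Qf : Q (phi f).
  have Qs : Q (s f).
    rewrite /s big_seq; apply: big_ind; [exact: idl0|by move=> *; apply: idlD|].
    move=> b bS; apply: mem_mulI; last exact: my.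
    rewrite /m /= rho_phi; apply/eqP; rewrite to_residue_eq0; apply: dfP.
    by apply: SB; rewrite -mem_undup.
  have Qfv : Q (phi f - v).
    have -> : phi f - v = (phi f - s f - v) + s f by ring.
    exact: idlD.
  rewrite -[phi f](subrK v); apply: idlD => //; apply: Fker => //.
  have /eqP := Q_ker _ Qfv; rewrite rmorphB subr_eq0 => /eqP <-.
  by rewrite rho_phi; apply/eqP; rewrite to_residue_eq0.
have i0 := ideal_set0 A.
have frac := @to_loc_frac A P; have unit := @to_loc_unit A P.
have ker : forall a, phi a = 0 <-> sat PA [set 0] a := @to_loc_eq0 A P.
have iPP : ideal_set (addsq PA [set 0]) by apply: addsq_ideal.
have : ext phi PA (addsq PA [set 0]) (phi f).
  move: Qf; apply: mulI_min; first exact: ext_ideal.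
  move=> z w mz mw; have [a [t [Pt Ea]]] := frac z; have [b [r [Pr Eb]]] := frac w.
  exists (a * b), (t * r); split; first exact: primeM.
    by apply: mul_addsq => //; [exact: mP Ea mz|exact: mP Eb mw].
  rewrite !rmorphM /= -[to_loc P a]Ea -[to_loc P b]Eb; ring.
move=> [a [t [Pt Ha]]]; rewrite -rmorphM => /(phi_eq ker)[r Pr E].
exists (r * t); first exact: primeM.
have -> : r * t * f = r * (t * f - a) + r * a by ring.
by rewrite [X in X + _]E add0r; apply: idlMl.
Qed.

(** * The rank of the Jacobian matrix *)

Lemma minor_rank (K : fieldType) (s m r : nat) (M : 'M[K]_(s, m))
    (g : 'I_r -> 'I_s) (h : 'I_r -> 'I_m) :
  \det (mxsub g h M) != 0 -> (r <= \rank M)%N.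
Proof.
rewrite -unitfE -[_ \is a _]/(_ \in unitmx) => /mxrank_unit {1}<-.
have -> : mxsub g h M = rowsub g (colsub h M) by apply/matrixP => i j; rewrite !mxE.
have rowsub_le n n' (N : 'M[K]_(n, n')) (k : 'I_r -> 'I_n) : (\rank (rowsub k N) <= \rank N)%N.
  by apply: mxrankS; apply/row_subP => i; rewrite row_rowsub row_sub.
apply: leq_trans (rowsub_le _ _ _ _) _.
by rewrite -mxrank_tr -[X in (_ <= X)%N]mxrank_tr trmx_mxsub rowsub_le.
Qed.

Lemma exists_max_minor (K : fieldType) (s m : nat) (M : 'M[K]_(s, m)) :
  exists (g : 'I_(\rank M) -> 'I_s) (h : 'I_(\rank M) -> 'I_m),
    [/\ injective g, injective h & \det (mxsub g h M) != 0].
Proof.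
pose N := rowsub (maxrankfun M) M.
have fullN : row_full N^T by rewrite /row_full mxrank_tr; apply: maxrowsub_free.
exists (maxrankfun M), (fullrankfun fullN).
split; [exact: maxrankfun_inj|exact: fullrankfun_inj|].
have := fullrowsub_unit fullN; rewrite unitmxE unitfE -det_tr.
by congr (\det _ != 0); apply/matrixP => i j; rewrite !mxE.
Qed.

Section CommonDenominator.
Variables (A : comNzRingType) (P : prime_idealr A).

Lemma common_denominator n (w : 'I_n -> residue_field P) :
  exists2 s, s \notin P & exists c, forall i, to_residue P (c i) = to_residue P s * w i.
Proof.
suff [s Ps Hs] : exists2 s, s \notin P &
    forall i, i \in enum 'I_n -> exists c, to_residue P c = to_residue P s * w i.
  have /choice[c Hc] : forall i, exists c, to_residue P c = to_residue P s * w i.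
    by move=> i; apply: Hs; rewrite mem_enum.
  by exists s => //; exists c.
elim: (enum 'I_n) => [|i l [s Ps Hs]]; first by exists 1 => //; rewrite idealr1.
have [a [t [Pt E]]] := residue_frac (w i); exists (t * s).
  by rewrite prime_idealrM negb_or Ps andbT; apply/negP.
move=> j; rewrite inE => /orP[/eqP ->|/Hs[c Hc]]; last first.
  by exists (t * c); rewrite !rmorphM /= Hc mulrA.
exists (s * a); have t0 : to_residue P t != 0 by rewrite to_residue_eq0; apply/negP.
by rewrite !rmorphM /= E [_ / _]mulrC mulrACA divff // mul1r.
Qed.

End CommonDenominator.

(** * Gradients modulo P and independence in the cotangent space *)

Section JacobianRows.
Variables (p : nat) (A : comNzRingType) (B : set A) (P : prime_idealr A).
Hypotheses (p_char : p \in [pchar A]) (B_basis : absolute_p_basis p B).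
Variables (m : nat) (b : 'I_m -> A).

Local Notation PA := [set x | x \in P].

Definition grad (a : A) : 'rV[residue_field P]_m :=
  \row_j to_residue P (pderiv B (b j) a).

Let dB c := (pderiv_basis p_char B_basis c).1.

Lemma gradD a a' : grad (a + a') = grad a + grad a'.
Proof. by apply/rowP => j; rewrite !mxE (dB (b j)).1 rmorphD. Qed.

Lemma gradM c a : a \in P -> grad (c * a) = to_residue P c *: grad a.
Proof.
rewrite -to_residue_eq0 => /eqP a0; apply/rowP => j.
by rewrite !mxE (dB (b j)).2 rmorphD !rmorphM /= a0 mul0r addr0.
Qed.

Lemma grad_sq a : mulI PA PA a -> grad a = 0.
Proof.
have g0 : grad 0 = 0 by apply: (addrI (grad 0)); rewrite -gradD !addr0.
move=> Ha; suff [] : a \in P /\ grad a = 0 by [].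
move: a Ha; apply: (@mulI_min _ _ _ [set a | a \in P /\ grad a = 0]).
  split=> [|x y [xP x0] [yP y0]|x y [yP y0]] /=.
  - by rewrite rpred0.
  - by rewrite rpredD // gradD x0 y0 addr0.
  - by rewrite gradM // y0 scaler0 ring_quotient.idealMr.
move=> x y /= xP yP; rewrite ring_quotient.idealMr // gradM //.
by move: xP; rewrite -to_residue_eq0 => /eqP ->; rewrite scale0r.
Qed.

(** The gradient factors through the cotangent space, so a dependence there would give one between
    gradients. The list [Y] collects the gradients of the elements already adjoined to [K]. *)
Lemma indep_at_grad K (Y : seq 'rV[residue_field P]_m) (s : seq A) :
  ideal_set K -> (forall k, K k -> k \in P /\ grad k \in <<Y>>%VS) ->
  (forall x, x \in s -> x \in P) -> free (map grad s ++ Y) -> indep_at PA K s.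
Proof.
elim: s K Y => //= x s IHs K Y iK KY sP; rewrite free_cons => /andP[nx freeY].
have xP : x \in P by apply: sP; rewrite mem_head.
split; last first.
  apply: (IHs _ (grad x :: Y)); first exact: adj_ideal.
  - move=> y [c /KY[yP yY]].
    have cP : c * x \in P by apply: ring_quotient.idealMr.
    rewrite -[y](subrK (c * x)) gradD gradM // rpredD //; split=> //.
    rewrite memvD // ?memvZ //; last by apply: memv_span; rewrite mem_head.
    by rewrite span_cons (subvP (addvSr _ _)).
  - by move=> y ys; apply: sP; rewrite inE ys orbT.
  - rewrite (@perm_free _ _ _ (grad x :: map grad s ++ Y)) ?free_cons ?nx //.
    by rewrite -cat1s perm_catCA.
move=> [t Pt [k /KY[kP kY] /grad_sq Hk]]; move/negP: nx; apply.
have t0 : to_residue P t != 0 by rewrite to_residue_eq0; apply/negP.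
have E : to_residue P t *: grad x = grad k.
  by rewrite -gradM // -[t * x](subrK k) gradD Hk add0r.
rewrite -[grad x](scalerK t0) E memvZ //.
by rewrite span_cat (subvP (addvSr _ _)).
Qed.

End JacobianRows.

(** * Finiteness of the support and the Jacobian criterion *)

Lemma finite_deriv_support (p : nat) (A : comNzRingType) (B : set A) (s : nat)
    (f : 'I_s -> A) : p \in [pchar A] -> absolute_p_basis p B ->
  exists (m : nat) (b : 'I_m -> A), deriv_support B f b.
Proof.
move=> p_char B_basis.
have [S HS] : exists S : 'I_s -> seq A, forall j, (forall x, x \in S j -> B x) /\
    forall b', B b' -> b' \notin S j -> pderiv B b' (f j) = 0.
  suff /choice[S HS] : forall j, exists S : seq A, (forall x, x \in S -> B x) /\
    forall b', B b' -> b' \notin S -> pderiv B b' (f j) = 0 by exists S.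
  move=> j; have [S SB HS] := p_basis_ind p_char B_basis (f j).
  exists S; split=> // b' Bb' nb'; have [dD Db] := pderiv_basis p_char B_basis b'.
  have [DD DM] := dD.
  apply: (HS (fun x => pderiv B b' x = 0)) => [a|c cS|x y x0 y0|x y x0 y0].
  - exact: derivation_pth.
  - have /negPf E : b' != c by apply: contraNneq nb' => ->.
    by rewrite (Db _ (SB _ cS)) E.
  - by rewrite DD x0 y0 addr0.
  - by rewrite DM x0 y0 !mulr0 addr0.
pose T := undup (flatten (codom S)); exists (size T), (tnth (in_tuple T)).
split.
- by apply/tuple_uniqP; apply: undup_uniq.
- move=> i; have := mem_tnth i (in_tuple T); rewrite /= mem_undup.
  by move=> /flattenP[_ /codomP[j ->] /(HS j).1].
- move=> b' Bb' nb' j; apply: (HS j).2 => //; apply/negP => b'S; apply: nb'.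
  have /tnthP[i ->] : b' \in in_tuple T; last by exists i.
  by rewrite /= mem_undup; apply/flattenP; exists (S j) => //; apply: codom_f.
Qed.

Theorem proposition5p1 (p : nat) (A : comNzRingType) (B : set A)
    (s : nat) (f : 'I_s -> A) (J : idealr A) (P : prime_idealr A)
    (p_char : p \in [pchar A]) (A_regular : regular_ring A)
    (B_basis : absolute_p_basis p B)
    (J_gen : [set x | x \in J] = ideal_span (range f))
    (sJP : {subset J <= P}) :
  (exists (m : nat) (b : 'I_m -> A), deriv_support B f b) /\
  (forall (r m : nat) (b : 'I_m -> A),
     ideal_height (ideal_span (to_loc P @` [set x | x \in J])) r ->
     deriv_support B f b ->
     (regular_local (localization (prime_quot sJP)) <->
        rank_mod P (jacobian B f b) = r) /\
     (regular_local (localization (prime_quot sJP)) <->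
        exists (g : 'I_r -> 'I_s) (h : 'I_r -> 'I_m),
          [/\ injective g, injective h &
              \det (mxsub g h (jacobian B f b)) \notin P])).
Proof.
split; first exact: finite_deriv_support p_char B_basis.
move=> r m b ht [b_inj bB b_supp].
have [noethA regA] := A_regular.
pose PA := [set x | x \in P]; have pP : prime_set PA by apply: idealr_prime_set.
pose JA := [set x | x \in J]; have iJ : ideal_set JA by apply: idealr_ideal.
have fJ j : f j \in J.
  suff : JA (f j) by [].
  rewrite /JA J_gen adjs0_span; apply: mem_adjs; first exact: ideal_set0.
  exact: codom_f.
have dB c := (pderiv_basis p_char B_basis c).1.
(* [g] selects a maximal set of independent rows; the corresponding generators form [xs]. *)
pose M := map_mx (to_residue P) (jacobian B f b); pose g := maxrankfun M.
have rowM j : row j M = grad B P b (f j) by apply/rowP => k; rewrite !mxE.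
pose xs := [seq f (g i) | i <- enum 'I_(\rank M)].
have xsJ x : x \in xs -> JA x by move=> /mapP[i _ ->]; apply: fJ.
have size_xs : size xs = \rank M by rewrite size_map size_enum_ord.
have i0 := ideal_set0 A.
have ind : indep_at PA [set 0] xs.
  apply: (@indep_at_grad _ _ _ _ p_char B_basis _ b _ [::]) => //.
  - move=> _ ->; split; first exact: rpred0.
    rewrite (_ : grad B P b 0 = 0) ?mem0v //.
    by apply/rowP => j; rewrite !mxE (derivation0 (dB (b j))) rmorph0.
  - by move=> x /xsJ /sJP.
  - rewrite cats0 -map_comp.
    pose X := [tuple grad B P b (f (g i)) | i < \rank M].
    have -> : [seq (grad B P b \o f \o g) i | i <- enum 'I_(\rank M)] = X by [].
    apply/freeP => k; under eq_bigr do rewrite -tnth_nth tnth_mktuple -rowM.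
    move=> k0 i; suff : \row_i k i = 0 by move/rowP/(_ i); rewrite !mxE.
    apply: (row_free_inj (maxrowsub_free M)).
    rewrite mul0mx mulmx_sum_row -[RHS]k0; apply: eq_bigr => j _.
    by rewrite mxE row_rowsub.
have spanJ : JA `<=` sat PA (addsq PA (adjs [set 0] xs)).
  have ixs := adjs_ideal xs i0.
  rewrite /JA J_gen adjs0_span; apply: adjs_min.
  - by apply: sat_ideal => //; apply: addsq_ideal.
  - by move=> _ ->; apply: idl0; apply: sat_ideal => //; apply: addsq_ideal.
  move=> _ /codomP[j ->].
  have /submxP[w Ew] : (row j M <= rowsub g M)%MS.
    by rewrite (eq_maxrowsub M) row_sub.
  have [t Pt [c Hc]] := common_denominator (fun i => w 0 i).
  (* [y] is the relation between row [j] and the selected rows, cleared of its denominator [t],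
     lifted to the generators. *)
  pose y := t * f j + \sum_i (- c i) * f (g i).
  have yJ : y \in J.
    rewrite /y rpredD ?rpred_sum //; first exact: ring_quotient.idealMr.
    by move=> i _; apply: ring_quotient.idealMr.
  have dM c' a x : x \in P ->
      to_residue P (pderiv B c' (a * x)) = to_residue P a * to_residue P (pderiv B c' x).
    rewrite -to_residue_eq0 => /eqP x0.
    by rewrite (dB c').2 rmorphD !rmorphM /= x0 mul0r addr0.
  have dy c' : to_residue P (pderiv B c' y) =
      to_residue P t * (to_residue P (pderiv B c' (f j)) -
        \sum_i w 0 i * to_residue P (pderiv B c' (f (g i)))).
    rewrite (dB c').1 (derivation_sum _ _ (dB c')) rmorphD rmorph_sum mulrBr.
    rewrite /= dM ?sJP // mulr_sumr -sumrN; congr (_ + _); apply: eq_bigr => i _.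
    by rewrite /= dM ?sJP // rmorphN /= Hc mulNr mulrA.
  (* The derivatives of [y] along the [b k] vanish modulo P by the row relation, and those along the
     other elements of [B] because they vanish on every generator. *)
  have ysat : sat PA (addsq PA [set 0]) y.
    apply: (pderiv_kernel p_char B_basis); first exact: sJP.
    move=> c' Bc'; rewrite -to_residue_eq0 dy.
    have [[k _ <-]|nc'] := pselect (range b c'); last first.
      rewrite b_supp // rmorph0 sub0r big1 ?oppr0 ?mulr0 // => i _.
      by rewrite b_supp // rmorph0 mulr0.
    have /rowP/(_ k) := Ew; rewrite !mxE => ->.
    by under eq_bigr do rewrite !mxE; rewrite subrr mulr0.
  have iA := addsq_ideal pP ixs; have [u Pu Hu] := ysat.
  exists (u * t); first by apply: primeM => //; apply/negP.
  have -> : u * t * f j = u * y - u * (\sum_i (- c i) * f (g i)) by rewrite /y; ring.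
  apply: idlB => //; first by move: Hu; apply: addsq_mono; apply: sub_adjs.
  apply: idlMl => //; apply: idl_sum => // i; apply: idlMl => //.
  apply: sub_addsq => //; apply: mem_adjs => //.
  by apply/mapP; exists i; rewrite ?mem_enum.
have [d reg0] := (regular_localization P noethA).1 (regA P).
have [ht_ge ht_lt] := ideal_height_localization ht.
have [rank_le reg_rank] :=
  regular_quotient_criterion noethA pP iJ sJP reg0 xsJ ind spanJ ht_ge ht_lt.
rewrite size_xs in rank_le reg_rank.
have reg_iff := regular_quotient_localization sJP noethA.
have minorE (q : nat) (h : 'I_q -> 'I_s) (k : 'I_q -> 'I_m) :
    (\det (mxsub h k (jacobian B f b)) \notin P) = (\det (mxsub h k M) != 0).
  by rewrite -to_residue_eq0 -det_map_mx map_mxsub.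
split; rewrite reg_iff reg_rank //.
split=> [<-|[h [k [_ _]]]].
  have [h [k [h_inj k_inj det0]]] := exists_max_minor M.
  by exists h, k; rewrite minorE.
rewrite minorE => /minor_rank rM; apply/eqP.
by rewrite eqn_leq rank_le rM.
Qed.
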